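(* Any generalized Killing spinor on the $5$-dimensional sphere $\mathbb{S}^5$ (with its standard round metric of constant sectional curvature $1$) is a real Killing spinor.
   Context: On a Riemannian spin manifold $(M,g)$, $\Sigma M$ denotes the spinor bundle, regarded as a real vector bundle, with the connection $\nabla$ induced by the Levi-Civita connection, a $\nabla$-parallel Euclidean product $\langle\cdot,\cdot\rangle$, and Clifford multiplication by tangent vectors, which is skew-symmetric with $X\cdot Y+Y\cdot X=-2g(X,Y)$. In dimension $5$, $\Sigma M$ has real rank $8$ (the usual complex spinor bundle of complex rank $4$). A generalized Killing spinor is a non-zero section $\Psi$ of $\Sigma M$ such that $\nabla_X\Psi=A(X)\cdot\Psi$ for all vector fields $X$, where $A$ is some $g$-symmetric endomorphism field of $\mathrm{T}M$. It is a (real) Killing spinor if $A$ is a non-zero real constant multiple of the identity. *)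

(* Defs.v *)
From mathcomp Require Import all_boot all_order all_algebra.
From mathcomp Require Import all_classical all_reals all_analysis.
From mathcomp Require Import mxtens ring.

Set Implicit Arguments.
Unset Strict Implicit.
Unset Printing Implicit Defensive.

Import Order.TTheory GRing.Theory Num.Theory.
Import numFieldNormedType.Exports.

Local Open Scope classical_set_scope.
Local Open Scope ring_scope.

Section Smooth.
Context {R : realType} {V W : normedModType R}.

(* For V finite-dimensional and U open, this is the usual class C^n, since a
   function with continuous partial derivatives is C^1. *)
Fixpoint is_Ck (n : nat) (U : set V) (f : V -> W) : Prop :=
  (forall x, U x -> {for x, continuous f}) /\
  (if n is m.+1 then
     forall v, (forall x, U x -> derivable f x v) /\ is_Ck m U ('D_v f)
   else True).

(* Smoothness on a submanifold S of V: f is locally the restriction of a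
   C^oo function defined on an open subset of V.  The values of f outside S
   are irrelevant. *)
Definition smooth_on (S : set V) (f : V -> W) : Prop :=
  forall x, S x -> exists (U : set V) (g : V -> W),
    [/\ open U, U x, (forall n, is_Ck n U g) &
        forall y, U y -> S y -> g y = f y].

End Smooth.

Section SpinGeometry.
Context {R : realType}.

Definition dot (v w : 'rV[R]_6) : R := \sum_i v 0 i * w 0 i.

Definition sphere : set 'rV[R]_6 := [set x | dot x x = 1].
Definition tangent (x : 'rV[R]_6) : set 'rV[R]_6 := [set X | dot x X = 0].

(* The Clifford algebra Cl_6, with relations
   v w + w v = - 2 <v, w>, is isomorphic to the full matrix algebra M_8(R).
   The images gamma 0, ..., gamma 5 of the standard basis of R^6 are tensor
   products of real 2 x 2 matrices. *)
Definition mJ : 'M[R]_2 := \matrix_(i, j) ((i < j)%:R - (j < i)%:R).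
Definition mX : 'M[R]_2 := \matrix_(i, j) (i != j)%:R.
Definition mZ : 'M[R]_2 := \matrix_(i, j) ((i == j)%:R * (-1) ^+ i).

Ltac mx2 :=
  apply/matrixP; do 2![case; case=> [|[|//]] ?];
  rewrite !(mxE, big_ord_recl, big_ord0) /=; ring.

Lemma mJJ : mJ *m mJ = - 1.
Proof. by mx2. Qed.

Lemma mXX : mX *m mX = 1.
Proof. by mx2. Qed.

Lemma mZZ : mZ *m mZ = 1.
Proof. by mx2. Qed.

Lemma mXJ : mX *m mJ = - (mJ *m mX).
Proof. by mx2. Qed.

Lemma mZJ : mZ *m mJ = - (mJ *m mZ).
Proof. by mx2. Qed.

Lemma mZX : mZ *m mX = - (mX *m mZ).
Proof. by mx2. Qed.

Lemma tr_mJ : mJ^T = - mJ.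
Proof. by mx2. Qed.

Lemma tr_mX : mX^T = mX.
Proof. by mx2. Qed.

Lemma tr_mZ : mZ^T = mZ.
Proof. by mx2. Qed.

Definition tens3 (A B C : 'M[R]_2) : 'M[R]_8 := A *t B *t C.

Lemma tens3_mul A B C A' B' C' :
  tens3 A B C *m tens3 A' B' C' = tens3 (A *m A') (B *m B') (C *m C').
Proof.
transitivity ((A *t B *m (A' *t B')) *t (C *m C')); first exact: (@tensmx_mul _ (2 * 2) (2 * 2) 2 2 (2 * 2) 2)%N.
by rewrite tensmx_mul.
Qed.

Lemma tr_tens3 A B C : (tens3 A B C)^T = tens3 A^T B^T C^T.
Proof. by apply/matrixP=> i j; rewrite !mxE. Qed.

Lemma tens3N1 A B C : tens3 (- A) B C = - tens3 A B C.
Proof. by apply/matrixP=> i j; rewrite !mxE !mulNr. Qed.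

Lemma tens3N2 A B C : tens3 A (- B) C = - tens3 A B C.
Proof. by apply/matrixP=> i j; rewrite !mxE mulrN mulNr. Qed.

Lemma tens3N3 A B C : tens3 A B (- C) = - tens3 A B C.
Proof. by apply/matrixP=> i j; rewrite !mxE mulrN. Qed.

Lemma tens_scalar1 (m n : nat) :
  (1%:M : 'M[R]_m) *t (1%:M : 'M[R]_n) = 1%:M.
Proof.
apply/matrixP=> i j.
case: (mxtens_indexP i) => a b; case: (mxtens_indexP j) => c d.
rewrite tensmxE !mxE (can_eq (@mxtens_indexK m n)) xpair_eqE.
by case: (a == c); case: (b == d); rewrite /= ?mulr0 ?mulr1.
Qed.

Lemma tens3_1 : tens3 1 1 1 = 1.
Proof.
transitivity ((1%:M : 'M[R]_(2 * 2)%N) *t (1%:M : 'M[R]_2)); last first.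
  exact: (@tens_scalar1 (2 * 2) 2).
by rewrite -tens_scalar1.
Qed.

Definition gamma (i : 'I_6) : 'M[R]_8 :=
  nth 0 [:: tens3 mJ mX 1; tens3 mJ mZ 1;
            tens3 1 mJ mX; tens3 1 mJ mZ;
            tens3 mX 1 mJ; tens3 mZ 1 mJ] i.

Lemma gamma_sqr i : gamma i *m gamma i = - 1.
Proof.
case: i => [[|[|[|[|[|[|//]]]]]] ?]; rewrite /gamma /= tens3_mul;
  by rewrite ?mJJ ?mXX ?mZZ ?mulr1 ?mulmx1 ?mul1mx ?(tens3N1, tens3N2, tens3N3) tens3_1.
Qed.

Lemma gamma_anti i j : i != j -> gamma i *m gamma j = - (gamma j *m gamma i).
Proof.
case: i => [[|[|[|[|[|[|//]]]]]] ?]; case: j => [[|[|[|[|[|[|//]]]]]] ?] // _;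
  rewrite /gamma /= !tens3_mul ?mulmx1 ?mul1mx ?(mXJ, mZJ, mZX)
    ?(tens3N1, tens3N2, tens3N3) ?opprK //.
Qed.

Lemma tr_gamma i : (gamma i)^T = - gamma i.
Proof.
case: i => [[|[|[|[|[|[|//]]]]]] ?]; rewrite /gamma /= tr_tens3;
  by rewrite ?trmx1 ?(tr_mJ, tr_mX, tr_mZ) ?(tens3N1, tens3N2, tens3N3).
Qed.

Definition cliff (v : 'rV[R]_6) : 'M[R]_8 := \sum_i v 0 i *: gamma i.

Lemma cliff_clifford v w :
  cliff v * cliff w + cliff w * cliff v = (- (2 * dot v w))%:M.
Proof.
rewrite /cliff !mulr_suml; under eq_bigr do rewrite mulr_sumr.
under [X in _ + X]eq_bigr do rewrite mulr_sumr.
rewrite [X in _ + X]exchange_big -big_split /=.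
rewrite (eq_bigr (fun i => (- (2 * (v 0 i * w 0 i)))%:M)); last first.
  move=> i _; rewrite -big_split /= (bigD1 i) //= big1 ?addr0.
    rewrite -!scalerAl -!scalerAr [gamma i * _]gamma_sqr !scalerA.
    rewrite !scalerN -opprD -scalerDl -[RHS]scalemx1 -scaleNr.
    by congr (_ *: _); rewrite -[_ *: w 0 i]/(_ * _); ring.
  move=> j ji; rewrite -!scalerAl -!scalerAr !scalerA [w 0 j * _]mulrC.
  by rewrite [gamma j * _]gamma_anti // scalerN subrr.
by rewrite -raddf_sum /dot mulr_sumr -sumrN.
Qed.

Lemma cliffB v w : cliff (v - w) = cliff v - cliff w.
Proof. by rewrite /cliff -sumrB; apply: eq_bigr => i _; rewrite !mxE scalerBl. Qed.

Lemma cliffZ a v : cliff (a *: v) = a *: cliff v.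
Proof. by rewrite /cliff scaler_sumr; apply: eq_bigr => i _; rewrite !mxE scalerA. Qed.

Definition even_unit_products (P : set 'rV[R]_6) : set 'M[R]_8 :=
  [set u | exists s : seq 'rV[R]_6,
     [/\ forall v, v \in s -> sphere v /\ P v,
         ~~ odd (size s) & u = \prod_(v <- s) cliff v]].

(* R^5 is the orthogonal of the zeroth basis vector e_0 of R^6, so that
   Spin(5) is the stabilizer of e_0 in Spin(6). *)
Definition Spin6 : set 'M[R]_8 := even_unit_products setT.
Definition Spin5 : set 'M[R]_8 := even_unit_products [set v | v 0 0 = 0].

(* The double covering Spin(6) -> SO(6): covering u v is the vector w of R^6
   such that w = u v u^-1 in Cl_6. *)
Definition covering (u : 'M[R]_8) (v : 'rV[R]_6) : 'rV[R]_6 :=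
  xget 0 [set w | cliff w = u *m cliff v *m invmx u].

Lemma cliff_unit v : sphere v -> cliff v * - cliff v = 1.
Proof.
move=> v1; have := cliff_clifford v v; rewrite v1 mulr1 -mulr2n => h.
have two0 : (2 : R) != 0 by rewrite pnatr_eq0.
apply: (scalerI two0).
by rewrite mulrN scalerN scaler_nat h -[X in - X]scalemx1 scaleNr opprK.
Qed.

Lemma conj_unit v w : sphere v ->
  cliff v * cliff w * - cliff v = cliff ((2 * dot v w) *: v - w).
Proof.
move=> v1; rewrite cliffB cliffZ mulrN.
have /(canRL (addrK _)) -> := cliff_clifford v w.
rewrite mulrBl opprB -mulrA -[cliff v * cliff v]opprK -mulrN cliff_unit //.
by rewrite mulrN1 -scalemx1 -scalerAl mul1r scaleNr opprK addrC.
Qed.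

Lemma coveringP u v : Spin6 u -> cliff (covering u v) = u *m cliff v *m invmx u.
Proof.
move=> [s [s1 _ ->]]; rewrite /covering.
apply: (@xgetPex _ _ [set w | cliff w = _]).
elim: s v s1 => [|x s IHs] v s1; first by exists v; rewrite big_nil invmx1 mul1mx mulmx1.
have x1 : sphere x by case: (s1 x (mem_head _ _)).
have [y ys|w /= hw] := IHs v; first by apply: s1; rewrite inE ys orbT.
have unit_cliff y : sphere y -> cliff y \is a GRing.unit.
  move=> y1; apply/unitrP; exists (- cliff y).
  by rewrite mulNr -mulrN cliff_unit.
have su : \prod_(y <- s) cliff y \is a GRing.unit.
  rewrite big_seq; apply: rpred_prod => y ys; apply: unit_cliff.
  by case: (s1 y _) => //; rewrite inE ys orbT.
exists ((2 * dot x w) *: x - w) => /=.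
rewrite -conj_unit // hw big_cons; set p := \prod_(_ <- _) _ in su *.
have -> : - cliff x = (cliff x)^-1.
  by apply: (mulrI (unit_cliff x x1)); rewrite cliff_unit // divrr ?unit_cliff.
rewrite -[invmx (_ * _)]/((_ * _)^-1) invrM ?unit_cliff //.
by rewrite -!mulmxE !mulmxA.
Qed.

(* The bundle of positively oriented orthonormal frames of S^5 is SO(6): the
   image of e_0 is the base point and the images of e_1, ..., e_5 are the
   frame.  The spin structure of S^5 is thus the covering Spin(6) -> SO(6),
   with Spin(5) acting on Spin(6) by right multiplication. *)
Definition base_pt (u : 'M[R]_8) : 'rV[R]_6 := covering u (delta_mx 0 ord0).
Definition frame (u : 'M[R]_8) (i : 'I_5) : 'rV[R]_6 :=
  covering u (delta_mx 0 (lift ord0 i)).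

(* The generators e_1, ..., e_5 of Cl_5, acting on the spinor module R^8.  The
   element e_1 e_2 e_3 e_4 e_5 is central in Cl_5 with square -1 (see
   volume_comm and volume_sqr below): it is the complex structure for which
   R^8 is the usual complex spinor module of complex dimension 4. *)
Definition e5 (i : 'I_5) : 'M[R]_8 := gamma (lift ord0 i).

Definition volume : 'M[R]_8 := \prod_(i < 5) e5 i.

Lemma volumeE : volume = - tens3 1 mZ mJ.
Proof.
rewrite /volume !big_ord_recr big_ord0 /= mul1r /e5 /gamma /=.
rewrite -!mulmxE !tens3_mul -tens3N2.
by congr tens3; rewrite ?mul1mx ?mulmx1; mx2.
Qed.

Lemma volume_sqr : volume * volume = - 1.
Proof.
rewrite volumeE mulrN mulNr opprK -mulmxE tens3_mul mZZ mJJ mul1mx.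
by rewrite tens3N3 tens3_1.
Qed.

Lemma volume_comm i : volume * e5 i = e5 i * volume.
Proof.
rewrite volumeE mulrN mulNr -mulmxE; congr (- _).
case: i => [[|[|[|[|[|//]]]]] ?]; rewrite /e5 /gamma /= !tens3_mul;
  by rewrite ?mul1mx ?mulmx1 ?(mXJ, mZJ, mZX) ?(tens3N1, tens3N2, tens3N3) ?opprK.
Qed.

(* Sections of the spinor bundle Spin(6) x_{Spin(5)} R^8 of S^5, seen as
   Spin(5)-equivariant smooth maps on Spin(6): the value of the spinor field
   at base_pt u is the class of (u, Psi u). *)
Definition spinor_field (Psi : 'M[R]_8 -> 'cV[R]_8) : Prop :=
  smooth_on Spin6 Psi /\
  forall u h, Spin6 u -> Spin5 h -> Psi (u *m h) = invmx h *m Psi u.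

(* Clifford multiplication by X, tangent at base_pt u, on spinors written in
   the spin frame u. *)
Definition clifford_mul (u : 'M[R]_8) (X : 'rV[R]_6) (psi : 'cV[R]_8) :
    'cV[R]_8 :=
  \sum_(i < 5) dot X (frame u i) *: (e5 i *m psi).

(* The spinorial Levi-Civita connection along a curve c of spin frames, at
   time 0, with respect to the frame c 0:
     nabla_X Psi = X(Psi) + 1/4 sum_{i,j} <nabla_X e_i, e_j> e_i . e_j . Psi .
   The Levi-Civita connection of S^5 is the tangential part of the derivative
   in R^6; its normal part has no inner product with e_j. *)
Definition nabla_along (Psi : 'M[R]_8 -> 'cV[R]_8) (c : R -> 'M[R]_8) :
    'cV[R]_8 :=
  derive1 (Psi \o c) 0 +
  4^-1 *: \sum_(i < 5) \sum_(j < 5)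
    dot (derive1 (fun t => frame (c t) i) 0) (frame (c 0) j)
      *: (e5 i *m e5 j *m Psi (c 0)).

(* nabla_X Psi = psi at base_pt u, where psi is written in the spin frame u. *)
Definition is_nabla (Psi : 'M[R]_8 -> 'cV[R]_8) (u : 'M[R]_8)
    (X : 'rV[R]_6) (psi : 'cV[R]_8) : Prop :=
  forall c : R -> 'M[R]_8,
    (forall t, Spin6 (c t)) -> derivable c 0 1 -> c 0 = u ->
    derive1 (fun t => base_pt (c t)) 0 = X -> nabla_along Psi c = psi.

(* X *m A x is A(X) for X tangent at x.  Only the action of A x on tangent
   vectors at x is relevant; every endomorphism field of TS^5 is obtained in
   this way, extending it by 0 on the normal line. *)
Definition symmetric_endo_field (A : 'rV[R]_6 -> 'M[R]_6) : Prop :=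
  smooth_on sphere A /\
  forall x, sphere x ->
    (forall X, tangent x X -> tangent x (X *m A x)) /\
    (forall X Y, tangent x X -> tangent x Y ->
       dot (X *m A x) Y = dot X (Y *m A x)).

Definition generalized_killing_spinor (Psi : 'M[R]_8 -> 'cV[R]_8)
    (A : 'rV[R]_6 -> 'M[R]_6) : Prop :=
  [/\ spinor_field Psi,
      exists2 u, Spin6 u & Psi u != 0,
      symmetric_endo_field A &
      forall u X, Spin6 u -> tangent (base_pt u) X ->
        is_nabla Psi u X (clifford_mul u (X *m A (base_pt u)) (Psi u))].

Definition real_killing_spinor (Psi : 'M[R]_8 -> 'cV[R]_8)
    (A : 'rV[R]_6 -> 'M[R]_6) : Prop :=
  generalized_killing_spinor Psi A /\
  exists2 lambda : R, lambda != 0 &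
    forall x X, sphere x -> tangent x X -> X *m A x = lambda *: X.

End SpinGeometry.

(* Main.v *)
Require Import Defs.
From mathcomp Require Import all_boot all_order all_algebra.
From mathcomp Require Import all_classical all_reals all_analysis.
From mathcomp Require Import ring lra.

Set Implicit Arguments.
Unset Strict Implicit.
Unset Printing Implicit Defensive.

Import Order.TTheory GRing.Theory Num.Theory.
Import numFieldNormedType.Exports.

Local Open Scope classical_set_scope.
Local Open Scope ring_scope.

(* Write [Psi] as an equivariant map on Spin(6) and [a] for the matrix of [A] in
   the frame of a point [u].  In horizontal directions [Psi] has derivative
   [2 cl (a x) Psi], so [|Psi|] is constant; commuting the second derivatives
   (in a local extension of [Psi]) gives the curvature equation
     cl ((D_x a) y - (D_y a) x) psi = [cl (a x), cl (a y)] psi - 1/4 [cl x, cl y] psi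
   for the unit spinor [psi].  In dimension 5 let [J] be the volume element, and
   let [g0] and [g0 J] be the structures anticommuting with Clifford
   multiplication.  The vectors [psi, g0 psi, g0 J psi, e_i psi] form an
   orthonormal basis of R^8; hence [J psi = xi . psi] for a unit vector [xi], and
   each Q among [J, g0, g0 J] induces a skew matrix [w_Q] with square
   [-1 + xi xi^T].  Since [g0 psi] and [g0 J psi] are orthogonal to all
   [cl z psi], the curvature equation yields [4 a w_Q a = w_Q] for those two Q,
   whence [a xi = mu xi], and [a] commutes with [w_J].  Differentiating
   [a xi = mu xi] and contracting the curvature equation with [xi] and with
   [J psi] gives [4 a w_J a = w_J] and [4 mu a w_J = w_J].  Together these
   relations force [a = mu] and [4 mu^2 = 1], and then [mu] is constant. *)

(** * Clifford multiplication by vectors of R^5 on the spinor module R^8 *)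

Section SpinorModule.
Context {R : realType}.
Implicit Types (x y z : 'cV[R]_5) (v w : 'rV[R]_6) (psi : 'cV[R]_8).

Notation g0 := (gamma ord0 : 'M[R]_8).
Notation J := (volume : 'M[R]_8).

(** R^5 is taken as the hyperplane orthogonal to e_0, so that [covering u (emb x)] is the tangent
    vector with coordinates [x] in the frame of [u]. *)
Definition emb x : 'rV[R]_6 :=
  \row_i (if unlift ord0 i is Some j then x j 0 else 0).

Lemma emb0 x : emb x 0 0 = 0.
Proof. by rewrite mxE unlift_none. Qed.

Lemma embS x i : emb x 0 (lift ord0 i) = x i 0.
Proof. by rewrite mxE liftK. Qed.

Lemma dot_emb x y : dot (emb x) (emb y) = (x^T *m y) 0 0.
Proof.
rewrite /dot big_ord_recl emb0 mul0r add0r mxE.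
by apply: eq_bigr => i _; rewrite !embS mxE.
Qed.

Lemma embD x y : emb (x + y) = emb x + emb y.
Proof.
by apply/rowP => i; rewrite !mxE; case: unliftP => [j|] _; rewrite ?mxE ?addr0.
Qed.

Lemma embZ (a : R) x : emb (a *: x) = a *: emb x.
Proof.
by apply/rowP => i; rewrite !mxE; case: unliftP => [j|] _; rewrite ?mxE ?mulr0.
Qed.

Lemma cliffD v w : cliff (v + w) = cliff v + cliff w.
Proof.
rewrite /cliff -big_split; apply: eq_bigr => i _.
by rewrite mxE scalerDl.
Qed.

Definition cl x : 'M[R]_8 := cliff (emb x).

Lemma clE x : cl x = \sum_i x i 0 *: e5 i.
Proof.
rewrite /cl /cliff big_ord_recl emb0 scale0r add0r.
by apply: eq_bigr => i _; rewrite embS.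
Qed.

Lemma clD x y : cl (x + y) = cl x + cl y.
Proof. by rewrite /cl embD cliffD. Qed.

Lemma clZ (a : R) x : cl (a *: x) = a *: cl x.
Proof. by rewrite /cl embZ cliffZ. Qed.

Lemma tr_cliff v : (cliff v)^T = - cliff v.
Proof.
rewrite /cliff raddf_sum -sumrN; apply: eq_bigr => i _.
by rewrite /= linearZ /= tr_gamma scalerN.
Qed.

Lemma tr_cl x : (cl x)^T = - cl x.
Proof. exact: tr_cliff. Qed.

Lemma cl_clifford x y :
  cl x *m cl y + cl y *m cl x = (- (2 * (x^T *m y) 0 0))%:M.
Proof. by rewrite -dot_emb -cliff_clifford. Qed.

Lemma cliff_delta i : cliff (delta_mx 0 i) = gamma i :> 'M[R]_8.
Proof.
rewrite /cliff (bigD1 i) //= big1 ?addr0 ?mxE ?eqxx ?scale1r // => j ji.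
by rewrite mxE (negbTE ji) andbF scale0r.
Qed.

Lemma g0_cl x : g0 *m cl x = - (cl x *m g0).
Proof.
rewrite clE mulmx_sumr mulmx_suml -sumrN; apply: eq_bigr => i _.
by rewrite -scalemxAr -scalemxAl gamma_anti // scalerN.
Qed.

Lemma J_cl x : J *m cl x = cl x *m J.
Proof.
rewrite clE mulmx_sumr mulmx_suml; apply: eq_bigr => i _.
by rewrite -scalemxAr -scalemxAl mulmxE volume_comm.
Qed.

Lemma tr_J : J^T = - J.
Proof.
rewrite volumeE linearN /= tr_tens3 trmx1 tr_mZ tr_mJ.
by rewrite tens3N3.
Qed.

Lemma g0_J : g0 *m J = - (J *m g0).
Proof.
rewrite volumeE mulmxN mulNmx /gamma /= !tens3_mul.
by rewrite mulmx1 mul1mx mZX tens3N2 opprK.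
Qed.

Lemma g0_sqr : g0 *m g0 = - 1.
Proof. exact: gamma_sqr. Qed.

Lemma J_sqr : J *m J = - 1.
Proof. by rewrite mulmxE volume_sqr. Qed.

Lemma tr_g0 : g0^T = - g0.
Proof. exact: tr_gamma. Qed.

End SpinorModule.

(** * The Euclidean inner product of column vectors *)

Section InnerProduct.
Context {R : realType}.

Definition ip n (u v : 'cV[R]_n) : R := (u^T *m v) 0 0.

Lemma ipE n (u v : 'cV[R]_n) : ip u v = \sum_i u i 0 * v i 0.
Proof. by rewrite /ip mxE; apply: eq_bigr => i _; rewrite mxE. Qed.

Lemma ipC n (u v : 'cV[R]_n) : ip u v = ip v u.
Proof. by rewrite !ipE; apply: eq_bigr => i _; rewrite mulrC. Qed.

Lemma ipDr n (u v w : 'cV[R]_n) : ip u (v + w) = ip u v + ip u w.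
Proof. by rewrite /ip mulmxDr mxE. Qed.

Lemma ipZr n a (u v : 'cV[R]_n) : ip u (a *: v) = a * ip u v.
Proof. by rewrite /ip -scalemxAr mxE. Qed.

Lemma ipNr n (u v : 'cV[R]_n) : ip u (- v) = - ip u v.
Proof. by rewrite /ip mulmxN mxE. Qed.

Lemma ipDl n (u v w : 'cV[R]_n) : ip (v + w) u = ip v u + ip w u.
Proof. by rewrite ipC ipDr !(ipC u). Qed.

Lemma ipZl n a (u v : 'cV[R]_n) : ip (a *: v) u = a * ip v u.
Proof. by rewrite ipC ipZr (ipC u). Qed.

Lemma ipNl n (u v : 'cV[R]_n) : ip (- v) u = - ip v u.
Proof. by rewrite ipC ipNr (ipC u). Qed.

Lemma ip0r n (u : 'cV[R]_n) : ip u 0 = 0.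
Proof. by rewrite /ip mulmx0 mxE. Qed.

Lemma ip_adj m n (A : 'M[R]_(m, n)) u v : ip (A *m u) v = ip u (A^T *m v).
Proof. by rewrite /ip trmx_mul mulmxA. Qed.

Lemma ip_ext n (v w : 'cV[R]_n) : (forall x, ip x v = ip x w) -> v = w.
Proof.
move=> vw; apply/colP => i; have := vw (delta_mx i 0).
have ipd (u : 'cV[R]_n) : ip (delta_mx i 0) u = u i 0.
  by rewrite /ip trmx_delta -rowE mxE.
by rewrite !ipd.
Qed.

Lemma mulmx_ext m n (A B : 'M[R]_(m, n)) :
  (forall x : 'cV[R]_n, A *m x = B *m x) -> A = B.
Proof.
move=> AB; apply/matrixP => i j.
by have /colP/(_ i) := AB (delta_mx j 0); rewrite -!colE !mxE.
Qed.

Lemma ip_ge0 n (u : 'cV[R]_n) : 0 <= ip u u.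
Proof. by rewrite ipE; apply: sumr_ge0 => i _; rewrite -expr2 sqr_ge0. Qed.

Lemma ip_eq0 n (u : 'cV[R]_n) : (ip u u == 0) = (u == 0).
Proof.
apply/idP/eqP => [|->]; last by rewrite ip0r.
rewrite ipE psumr_eq0 => [/allP u0|i _]; last by rewrite -expr2 sqr_ge0.
apply/colP => i; rewrite mxE; apply/eqP.
by have := u0 i (mem_index_enum _); rewrite /= mulf_eq0 orbb.
Qed.

Lemma ip_skew n (K : 'M[R]_n) u : K^T = - K -> ip u (K *m u) = 0.
Proof.
move=> Ks; have := ip_adj K u u; rewrite Ks mulNmx ipNr ipC => h.
lra.
Qed.

Lemma col_ip n m (p : 'cV[R]_n) (u : 'cV[R]_m) (v : 'cV[R]_m) :
  p *m u^T *m v = ip u v *: p.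
Proof.
by rewrite -mulmxA [u^T *m v]mx11_scalar mul_mx_scalar.
Qed.

End InnerProduct.

(** * Clifford products applied to a single spinor *)

Section Pointwise.
Context {R : realType}.
Implicit Types (x y z : 'cV[R]_5) (psi : 'cV[R]_8).

Local Notation g0 := (gamma ord0 : 'M[R]_8).
Local Notation J := (volume : 'M[R]_8).

Definition spin_mx psi : 'M[R]_(8, 5) := \matrix_(r, j) (e5 j *m psi) r 0.

Lemma spin_mxE psi x : spin_mx psi *m x = cl x *m psi.
Proof.
rewrite clE mulmx_suml; apply/colP => r; rewrite mxE summxE.
by apply: eq_bigr => i _; rewrite [spin_mx _ _ _]mxE -scalemxAl [RHS]mxE mulrC.
Qed.

Lemma ip_cl x u v : ip (cl x *m u) v = - ip u (cl x *m v).
Proof. by rewrite ip_adj tr_cl mulNmx ipNr. Qed.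

Lemma ip_J u v : ip (J *m u) v = - ip u (J *m v).
Proof. by rewrite ip_adj tr_J mulNmx ipNr. Qed.

Lemma clcl x y (psi : 'cV[R]_8) :
  cl x *m (cl y *m psi) = - (cl y *m (cl x *m psi)) - (2 * ip x y) *: psi.
Proof.
rewrite !mulmxA; have /(canRL (addrK _)) -> := cl_clifford x y.
by rewrite mulmxDl mulNmx addrC mul_scalar_mx scaleNr.
Qed.

(** Skewness moves one factor across the inner product, and the Clifford relation compares the two
    orders of the product. Hence [spin_mx psi] is an isometry for a unit spinor. *)
Lemma ip_clcl (psi : 'cV[R]_8) x y :
  ip (cl x *m psi) (cl y *m psi) = ip x y * ip psi psi.
Proof.
have := ip_cl y psi (cl x *m psi).
rewrite clcl ipDr !ipNr ipZr opprD !opprK ipC.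
have := ip_cl x psi (cl y *m psi); rewrite (ipC y x); lra.
Qed.

Section Unit.
Context (psi : 'cV[R]_8) (psi1 : ip psi psi = 1).
Local Notation M := (spin_mx psi).

Lemma spin_mx_orth : M^T *m M = 1%:M.
Proof.
apply: mulmx_ext => x; apply: ip_ext => y.
by rewrite mul1mx -mulmxA -ip_adj !spin_mxE ip_clcl psi1 mulr1.
Qed.

Lemma ip_psi_cl x : ip psi (cl x *m psi) = 0.
Proof. by apply: ip_skew; rewrite tr_cl. Qed.

Lemma spin_mx_psi : M^T *m psi = 0.
Proof.
by apply: ip_ext => y; rewrite -ip_adj spin_mxE ipC ip_psi_cl ip0r.
Qed.

Section Anticommuting.
Context (Q : 'M[R]_8) (Qskew : Q^T = - Q).
Context (Qcl : forall x, Q *m cl x = - (cl x *m Q)).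

Lemma ip_Q u v : ip (Q *m u) v = - ip u (Q *m v).
Proof. by rewrite ip_adj Qskew mulNmx ipNr. Qed.

(** The product [Q *m cl x] is skew: transposition reverses two skew factors, and anticommutation
    restores their order with a sign. *)
Lemma ip_Q_cl x : ip (Q *m psi) (cl x *m psi) = 0.
Proof.
rewrite ip_Q mulmxA ip_skew ?oppr0 //.
by rewrite trmx_mul tr_cl Qskew mulNmx mulmxN opprK Qcl opprK.
Qed.

Lemma spin_mx_Q : M^T *m (Q *m psi) = 0.
Proof.
by apply: ip_ext => y; rewrite -ip_adj spin_mxE ipC ip_Q_cl ip0r.
Qed.

(** Moving [Q] past [cl x] leaves the bilinear form of [Q] on the vectors [cl z *m psi], whose
    matrix is named [omega psi Q] below. *)
Lemma ip_Q_clcl x y :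
  ip (Q *m psi) (cl x *m (cl y *m psi)) = - ip x (M^T *m Q *m M *m y).
Proof.
rewrite -2!mulmxA -ip_adj !spin_mxE.
rewrite -[LHS]opprK -ip_cl mulmxA -[cl x *m Q]opprK -Qcl mulNmx ipNl opprK.
by rewrite -mulmxA ip_Q.
Qed.

End Anticommuting.

End Unit.
End Pointwise.

(** * The orthonormal basis of R^8 attached to a unit spinor *)

Section Quaternionic.
Context {R : realType}.
Implicit Types (x y z : 'cV[R]_5).
Local Notation g0 := (gamma ord0 : 'M[R]_8).
Local Notation J := (volume : 'M[R]_8).
Local Notation Q3 := (g0 *m J).

Lemma Q3_skew : Q3^T = - Q3 :> 'M[R]_8.
Proof. by rewrite trmx_mul tr_J tr_g0 mulNmx mulmxN opprK g0_J opprK. Qed.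

Lemma Q3_cl x : Q3 *m cl x = - (cl x *m Q3).
Proof. by rewrite -mulmxA J_cl mulmxA g0_cl mulNmx mulmxA. Qed.

Lemma Q3_sqr : Q3 *m Q3 = - 1.
Proof.
rewrite {2}g0_J mulmxN !mulmxA -(mulmxA g0 J J) J_sqr mulmxN mulNmx opprK.
by rewrite mulmx1 g0_sqr.
Qed.

Lemma g0_Q3 : g0 *m Q3 = - J.
Proof. by rewrite mulmxA g0_sqr mulNmx mul1mx. Qed.

Lemma J_Q3 : J *m Q3 = g0.
Proof. by rewrite mulmxA -[J *m g0]opprK -g0_J mulNmx -mulmxA J_sqr mulmxN mulmx1 opprK. Qed.

Context (psi : 'cV[R]_8) (psi1 : ip psi psi = 1).
Local Notation M := (spin_mx psi).

Let tr_mul1 n (u v : 'cV[R]_n) : u^T *m v = (ip u v)%:M.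
Proof. exact: mx11_scalar. Qed.

(** The vectors [psi], [g0 *m psi], [Q3 *m psi] and the five [e5 i *m psi] are orthonormal, hence a
    basis of R^8, and the sum of their projectors is the identity. *)
Lemma spin_mx_compl :
  M *m M^T = 1 - psi *m psi^T - (g0 *m psi) *m (g0 *m psi)^T
    - (Q3 *m psi) *m (Q3 *m psi)^T.
Proof.
pose B : 'M[R]_(8, 1 + 1 + 1 + 5) :=
  row_mx (row_mx (row_mx psi (g0 *m psi)) (Q3 *m psi)) M.
have BE : B *m B^T = psi *m psi^T + (g0 *m psi) *m (g0 *m psi)^T
    + (Q3 *m psi) *m (Q3 *m psi)^T + M *m M^T.
  by rewrite /B !tr_row_mx !mul_row_col.
have zip u v : ip u v = 0 -> u^T *m v = 0 :> 'M[R]_1.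
  by move=> uv; rewrite tr_mul1 uv raddf0.
have i02 : ip psi (g0 *m psi) = 0 by rewrite ip_skew // tr_g0.
have i03 : ip psi (Q3 *m psi) = 0 by rewrite ip_skew // Q3_skew.
have i23 : ip (g0 *m psi) (Q3 *m psi) = 0.
  by rewrite ip_Q ?tr_g0 // mulmxA g0_Q3 mulNmx ipNr ip_skew ?oppr0 // tr_J.
have i22 : ip (g0 *m psi) (g0 *m psi) = 1.
  by rewrite ip_Q ?tr_g0 // mulmxA g0_sqr mulNmx mul1mx ipNr psi1 opprK.
have i33 : ip (Q3 *m psi) (Q3 *m psi) = 1.
  by rewrite ip_Q ?Q3_skew // mulmxA Q3_sqr mulNmx mul1mx ipNr psi1 opprK.
have m2 := spin_mx_Q psi (@tr_g0 R) (@g0_cl R).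
have m3 := spin_mx_Q psi Q3_skew Q3_cl.
have m0 := spin_mx_psi psi.
have tr0 (u : 'cV[R]_8) : M^T *m u = 0 -> u^T *m M = 0.
  by move=> h; rewrite -[LHS]trmxK trmx_mul trmxK h trmx0.
have BB : B^T *m B = 1%:M.
  rewrite /B !tr_row_mx !(mul_col_row, mul_col_mx, mul_mx_row).
  rewrite spin_mx_orth // m0 m2 m3 !tr0 // !row_mx0 !col_mx0.
  rewrite (zip _ _ _ i02) (zip _ _ _ i03) (zip _ _ _ i23).
  move: i02 i03 i23; rewrite ![ip psi _]ipC [ip _ (Q3 *m psi)]ipC => i20 i30 i32.
  rewrite (zip _ _ _ i20) (zip _ _ _ i30) (zip _ _ _ i32).
  rewrite !tr_mul1 psi1 i22 i33 !row_mx0 !col_mx0.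
  by rewrite -!scalar_mx_block.
(* [B] is square because 1 + 1 + 1 + 5 = 8, so its left inverse is also a right inverse. *)
have {}BB : B *m B^T = 1 by exact: (@mulmx1C _ 8 B^T B BB).
do 3!apply: (canRL (addrK _)); rewrite -BB BE.
by rewrite [RHS](ACl (4 * 3 * 2 * 1)).
Qed.

End Quaternionic.

(** * The 2-forms and the vector xi of a unit spinor, and the curvature equation at a point *)

Section Structure.
Context {R : realType}.
Implicit Types (x y z : 'cV[R]_5).
Local Notation g0 := (gamma ord0 : 'M[R]_8).
Local Notation J := (volume : 'M[R]_8).
Local Notation Q3 := (g0 *m J).

Context (psi : 'cV[R]_8) (psi1 : ip psi psi = 1).
Local Notation M := (spin_mx psi).

(** For skew [Q], this is the matrix of the 2-form (x, y) -> <x . psi, Q (y . psi)>. *)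
Definition omega (psi : 'cV[R]_8) (Q : 'M[R]_8) : 'M[R]_5 :=
  (spin_mx psi)^T *m Q *m spin_mx psi.

(* The unit vector [xi] such that the complex structure [volume] maps [psi] to
   [cl xi *m psi]. *)
Definition reeb (psi : 'cV[R]_8) : 'cV[R]_5 :=
  (spin_mx psi)^T *m (volume *m psi).

Local Notation w := (omega psi).
Local Notation xi := (reeb psi).

Lemma omega_skew Q : Q^T = - Q -> (w Q)^T = - w Q.
Proof.
by move=> Qs; rewrite /omega !trmx_mul trmxK Qs mulNmx mulmxN mulmxA.
Qed.

(** Between the two factors stands the projector [M *m M^T]; [spin_mx_compl] replaces it by the
    identity minus three rank-one terms, whose sign is reversed by the skewness of [Q']. *)
Lemma omega_mul Q Q' : Q'^T = - Q' -> w Q *m w Q' = w (Q *m Q')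
  + (M^T *m (Q *m psi)) *m (M^T *m (Q' *m psi))^T
  + (M^T *m (Q *m g0 *m psi)) *m (M^T *m (Q' *m g0 *m psi))^T
  + (M^T *m (Q *m Q3 *m psi)) *m (M^T *m (Q' *m Q3 *m psi))^T.
Proof.
move=> Qs.
have H (u : 'cV[R]_8) : (M^T *m (Q' *m u))^T = - (u^T *m Q' *m M).
  by rewrite !trmx_mul trmxK Qs mulmxN mulNmx.
have H2 (u : 'cV[R]_8) : (M^T *m (Q *m u)) *m (M^T *m (Q' *m u))^T =
    - ((M^T *m Q) *m (u *m u^T) *m (Q' *m M)).
  by rewrite H mulmxN !mulmxA.
rewrite -!(mulmxA Q) -!(mulmxA Q') !H2 /omega.
have -> : M^T *m Q *m M *m (M^T *m Q' *m M) =
   (M^T *m Q) *m (M *m M^T) *m (Q' *m M) by rewrite !mulmxA.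
rewrite spin_mx_compl // !mulmxBr !mulmxBl mulmx1; congr (_ - _ - _ - _).
by rewrite !mulmxA.
Qed.

Let s0 := spin_mx_psi psi.
Let s2 := spin_mx_Q psi (@tr_g0 R) (@g0_cl R).
Let s3 := spin_mx_Q psi (@Q3_skew R) (@Q3_cl R).

Let omegaN1 : w (- 1) = - 1%:M.
Proof. by rewrite /omega mulmxN mulmx1 mulNmx spin_mx_orth. Qed.

(** In [omega_mul] only the [Q3] term survives, because [g0 *m Q3 = - J] and [J *m psi] projects to
    [xi]. *)
Lemma omega_g0_sqr : w g0 *m w g0 = - 1%:M + xi *m xi^T.
Proof.
rewrite omega_mul ?tr_g0 // g0_sqr g0_Q3 omegaN1 s2 mul0mx addr0.
rewrite !mulNmx mul1mx !mulmxN s0 oppr0 mul0mx addr0.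
by rewrite linearN mulmxN mulNmx opprK.
Qed.

Lemma omega_J_sqr : w J *m w J = - 1%:M + xi *m xi^T.
Proof.
rewrite omega_mul ?tr_J // J_sqr omegaN1 J_Q3 s2 mul0mx addr0.
rewrite -[J *m g0]opprK -g0_J mulNmx mulmxN s3 oppr0 mul0mx addr0.
by [].
Qed.

Lemma omega_g0_Q3 : w g0 *m w Q3 = - w J.
Proof.
rewrite omega_mul ?Q3_skew // s2 mul0mx addr0 g0_sqr g0_Q3 Q3_sqr.
rewrite !mulNmx mul1mx !mulmxN s0 oppr0 mul0mx trmx0 mulmx0 !addr0.
by rewrite /omega mulmxN mulNmx.
Qed.

(** [J *m psi] is orthogonal to [psi], [g0 *m psi] and [Q3 *m psi], so [M *m M^T] fixes it. *)
Lemma spin_mx_reeb : M *m xi = J *m psi.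
Proof.
rewrite /reeb mulmxA spin_mx_compl // !mulmxBl mul1mx !col_ip.
have -> : ip psi (J *m psi) = 0 by rewrite ip_skew // tr_J.
rewrite ip_Q ?tr_g0 // mulmxA ip_skew ?Q3_skew //.
rewrite ip_Q ?Q3_skew // [Q3 *m (J *m psi)]mulmxA -(mulmxA g0) J_sqr mulmxN mulmx1 mulNmx.
by rewrite ipNr ip_skew ?tr_g0 // !oppr0 !scale0r !subr0.
Qed.

Lemma omega_reeb Q : w Q *m xi = M^T *m (Q *m (J *m psi)).
Proof. by rewrite /omega -mulmxA spin_mx_reeb -!mulmxA. Qed.

Lemma omega_g0_reeb : w g0 *m xi = 0.
Proof. by rewrite omega_reeb (mulmxA g0) s3. Qed.

Lemma omega_J_reeb : w J *m xi = 0.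
Proof.
by rewrite omega_reeb (mulmxA J) J_sqr mulNmx mul1mx mulmxN s0 oppr0.
Qed.

Lemma ip_reeb : ip xi xi = 1.
Proof.
rewrite {1}/reeb ip_adj trmxK spin_mx_reeb ip_J mulmxA J_sqr.
by rewrite mulNmx mul1mx ipNr opprK.
Qed.

(* [a] is the endomorphism field in an orthonormal frame and [C] its covariant
   exterior derivative; the last term is the curvature of the unit sphere. *)
Context (a : 'M[R]_5) (aT : a^T = a) (C : 'cV[R]_5 -> 'cV[R]_5 -> 'cV[R]_5).
Context (curvature : forall x y, cl (C x y) *m psi =
  cl (a *m x) *m (cl (a *m y) *m psi) - cl (a *m y) *m (cl (a *m x) *m psi)
  - 4^-1 *: (cl x *m (cl y *m psi) - cl y *m (cl x *m psi))).

(** Pair the curvature equation with [Q *m psi]: the left side vanishes by [ip_Q_cl], and each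
    Clifford product becomes a value of the 2-form of [Q]. *)
Lemma omega_conj Q : Q^T = - Q -> (forall x, Q *m cl x = - (cl x *m Q)) ->
  4 *: (a *m w Q *m a) = w Q.
Proof.
move=> Qs Qc; apply: mulmx_ext => y; apply: ip_ext => x.
have := congr1 (ip (Q *m psi)) (curvature x y).
rewrite ip_Q_cl // !(ipDr, ipNr, ipZr) !ip_Q_clcl // -/(w Q).
have ws u v : ip u (w Q *m v) = - ip v (w Q *m u).
  by rewrite ipC ip_adj omega_skew // mulNmx ipNr.
rewrite (ws (a *m y)) (ws y) -!mulmxA -scalemxAl ipZr -!mulmxA.
rewrite ip_adj aT => h; lra.
Qed.

Let c2 : 4 *: (a *m w g0 *m a) = w g0.
Proof. by apply: omega_conj; [exact: tr_g0|exact: g0_cl]. Qed.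
Let c3 : 4 *: (a *m w Q3 *m a) = w Q3.
Proof. by apply: omega_conj; [exact: Q3_skew|exact: Q3_cl]. Qed.

Definition reeb_eigenvalue (a : 'M[R]_5) (psi : 'cV[R]_8) : R :=
  ip (reeb psi) (a *m reeb psi).

(** As [w g0] kills [xi], the relation [c2] puts [y] in the kernel of [a], and then in the kernel of
    [w g0]. Since [w g0] squares to minus the projection orthogonal to [xi], only the [xi] component
    of [a *m xi] remains. *)
Lemma reeb_eigen : a *m xi = reeb_eigenvalue a psi *: xi.
Proof.
pose y := w g0 *m (a *m xi).
have ay : a *m y = 0.
  have := omega_g0_reeb; rewrite -c2 -scalemxAl => /eqP.
  rewrite scaler_eq0 pnatr_eq0 /= => /eqP.
  by rewrite /y -!mulmxA.
have : w g0 *m y = 0 by rewrite -c2 -scalemxAl -mulmxA ay mulmx0 scaler0.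
rewrite /y mulmxA omega_g0_sqr mulmxDl mulNmx mul1mx col_ip => /eqP.
by rewrite addrC subr_eq0 => /eqP.
Qed.

(** Up to sign [w J] is [w g0 *m w Q3]. Replacing [w Q3] by [4 *: (a *m w Q3 *m a)] and then using
    the same relation for [w g0] carries [a] from left to right. *)
Lemma omega_J_comm : a *m w J = w J *m a.
Proof.
have -> : w J = - (w g0 *m w Q3) by rewrite omega_g0_Q3 opprK.
rewrite mulmxN mulNmx; congr (- _).
transitivity (4 *: (a *m w g0 *m a *m w Q3 *m a)).
  by rewrite -{1}c3 -!scalemxAr !mulmxA.
by rewrite -{2}c2 -!scalemxAl.
Qed.

End Structure.

(** * Rigidity: the endomorphism is a multiple of the identity *)

Section Rigidity.
Context {R : realType}.
Implicit Types (x y z : 'cV[R]_5).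
Local Notation J := (volume : 'M[R]_8).

Context (psi : 'cV[R]_8) (psi1 : ip psi psi = 1).
Local Notation M := (spin_mx psi).
Local Notation w := (omega psi J).
Local Notation xi := (reeb psi).

Context (a : 'M[R]_5) (aT : a^T = a).
Context (da : 'cV[R]_5 -> 'M[R]_5) (daT : forall x, (da x)^T = da x).
Context (curvature : forall x y, cl (da x *m y - da y *m x) *m psi =
  cl (a *m x) *m (cl (a *m y) *m psi) - cl (a *m y) *m (cl (a *m x) *m psi)
  - 4^-1 *: (cl x *m (cl y *m psi) - cl y *m (cl x *m psi))).

Local Notation mu := (reeb_eigenvalue a psi).

(* The derivative of [a *m xi = mu *: xi], where the derivative of [xi] in the
   direction [x] is [2 *: (w *m (a *m x))]. *)
Context (dmu : 'cV[R]_5 -> R).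
Context (deigen : forall x, da x *m xi + a *m (2 *: (w *m (a *m x))) =
  dmu x *: xi + mu *: (2 *: (w *m (a *m x)))).

Let eig : a *m xi = mu *: xi.
Proof. exact: (reeb_eigen psi1 aT curvature). Qed.
Let aw : a *m w = w *m a.
Proof. exact: (omega_J_comm psi1 aT curvature). Qed.

Let ws u v : ip u (w *m v) = - ip v (w *m u).
Proof. by rewrite ipC ip_adj omega_skew ?tr_J // mulNmx ipNr. Qed.

Let adj u v : ip u (a *m v) = ip v (a *m u).
Proof. by rewrite ipC ip_adj aT. Qed.

Let dadj t u v : ip u (da t *m v) = ip v (da t *m u).
Proof. by rewrite ipC ip_adj daT. Qed.

Let daxi x : da x *m xi =
  dmu x *: xi + (2 * mu) *: (w *m (a *m x)) - 2 *: (a *m (w *m (a *m x))).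
Proof.
have /(canRL (addrK _)) -> := deigen x.
by rewrite -scalemxAr scalerA (mulrC mu).
Qed.

Let cl_xi : cl xi *m psi = J *m psi.
Proof. by rewrite -spin_mxE spin_mx_reeb //. Qed.

Let ip_cl_J z x : ip (cl z *m psi) (cl x *m (J *m psi)) = ip z (w *m x).
Proof.
by rewrite /omega -2!mulmxA -ip_adj !spin_mxE !mulmxA J_cl.
Qed.

Let ip_J_clcl x y : ip (J *m psi) (cl x *m (cl y *m psi)) = ip x (w *m y).
Proof. by rewrite -[LHS]opprK -ip_cl ipC ip_cl_J -ws. Qed.

(** This is the curvature equation at (x, xi) paired with [cl z *m psi]. Because [xi] acts on [psi]
    as [J], commutators with [cl xi] give values of [w], and the terms in [mu] cancel. *)
Let E3 x z : dmu x * ip z xi - 2 * ip z (a *m (w *m (a *m x)))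
  - ip z (da xi *m x) = - 2^-1 * ip z (w *m x).
Proof.
have H p : ip (cl z *m psi) (cl p *m (cl xi *m psi)) -
    ip (cl z *m psi) (cl xi *m (cl p *m psi)) = 2 * ip z (w *m p).
  rewrite (clcl xi) !(ipDr, ipNr, ipZr) [ip _ psi]ipC ip_psi_cl.
  rewrite cl_xi ip_cl_J; ring.
have := congr1 (ip (cl z *m psi)) (curvature x xi).
rewrite eig !clZ -!scalemxAl -!scalemxAr !(ipDr, ipNr, ipZr) -mulrBr !H.
by rewrite ip_clcl psi1 mulr1 ipDr ipNr daxi !(ipDr, ipNr, ipZr) => h; lra.
Qed.

(** Antisymmetrizing [E3] in [x] and [z] removes the term in [da xi], which is symmetric. *)
Let E x z : dmu x * ip z xi - dmu z * ip x xi =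
  4 * ip z (a *m (w *m (a *m x))) - ip z (w *m x).
Proof.
have := E3 x z; have := E3 z x.
rewrite (ws x z) (adj x) [ip (w *m _) _]ipC (ws (a *m x)) [ip (a *m z) _]ipC (adj _ z).
rewrite (dadj _ x); lra.
Qed.

(** Put [z = xi] in [E]: the right side vanishes since [w] kills [xi] and [a] preserves its line.
    The gradient of [mu] is thus along [xi], and the left side of [E] is zero. *)
Let dmuE x : dmu x = dmu xi * ip x xi.
Proof.
have := E x xi; rewrite ip_reeb // (adj xi) eig ipZr [ip (w *m _) xi]ipC !(ws xi).
by rewrite omega_J_reeb // !ip0r; lra.
Qed.

Lemma omega_J_conj : 4 *: (a *m w *m a) = w.
Proof.
apply: mulmx_ext => x; apply: ip_ext => z.
have := E x z; rewrite (dmuE x) (dmuE z) -scalemxAl ipZr -!mulmxA; lra.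
Qed.

Let awa z x : ip z (a *m (w *m (a *m x))) = 4^-1 * ip z (w *m x).
Proof.
have := congr1 (fun B => ip z (B *m x)) omega_J_conj.
rewrite -scalemxAl ipZr -!mulmxA; lra.
Qed.

(** Pair the curvature equation with [J *m psi]. The left side is computed from [daxi], where the
    [dmu] terms cancel by [dmuE]; the right side vanishes by [omega_J_conj]. *)
Lemma omega_J_scale : (4 * mu) *: (w *m a) = w.
Proof.
apply: mulmx_ext => x; apply: ip_ext => y.
have HL c : ip (J *m psi) (cl c *m psi) = ip c xi.
  by rewrite -spin_mxE ipC ip_adj.
have := congr1 (ip (J *m psi)) (curvature x y).
rewrite HL ipDl ipNl ![ip (da _ *m _) _]ipC (dadj x) (dadj y) !daxi.
rewrite !(ipDr, ipNr, ipZr) !ip_J_clcl (dmuE x) (dmuE y).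
have K u v : ip (a *m u) v = ip u (a *m v) by rewrite ip_adj aT.
rewrite !K !awa (ws x y).
have -> : ip x (w *m (a *m y)) = - ip y (w *m (a *m x)).
  by rewrite ws ipC (mulmxA w) -aw -mulmxA adj ipC.
rewrite -scalemxAl ipZr -mulmxA; lra.
Qed.

(** The square [P] of [w] is minus the projector orthogonal to [xi]. Combining the relations for
    [a *m P] and [a *m (a *m P)] gives [a *m P = mu *: P], so [a] acts by [mu] both along [xi] and
    across it. *)
Lemma killing_rigidity : a = mu%:M /\ 4 * mu ^+ 2 = 1.
Proof.
have P2 := omega_J_sqr psi1.
set P := - _ + _ in P2.
have aP1 : (4 * mu) *: (a *m P) = P.
  by rewrite -P2 mulmxA aw scalemxAl omega_J_scale.
have aP2 : 4 *: (a *m (a *m P)) = P.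
  by rewrite -P2 (mulmxA a w) aw (mulmxA a) (mulmxA a w) scalemxAl omega_J_conj.
have aP : a *m P = mu *: P.
  rewrite -{2}aP2 -{1}aP1 -!scalemxAr !scalerA; congr (_ *: _); ring.
have aE : a = mu%:M.
  have : a *m (xi *m xi^T - P) = mu *: (xi *m xi^T - P).
    by rewrite mulmxBr mulmxA eig aP scalerBr -scalemxAl.
  rewrite /P opprD opprK addrC addrNK mulmx1 => {1}->.
  by rewrite scalemx1.
split=> //.
(* [aP1] now reads [4 mu^2 P = P], and the trace -4 of [P] is non-zero. *)
have := congr1 mxtrace aP1; rewrite aP scalerA mxtraceZ.
have -> : \tr P = - 4.
  rewrite /P mxtraceD mxtrace_mulC raddfN /= mxtrace1.
  have -> : \tr (xi^T *m xi) = 1 by rewrite [_ *m _]mx11_scalar mxtrace_scalar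
      -/(ip _ _) ip_reeb.
  ring.
move=> h; lra.
Qed.

End Rigidity.

(** * Directional derivatives: mean values, symmetry of second derivatives, chain rule *)

Lemma is_derive_cvg {R : realType} {V W : normedModType R} (f : V -> W) x v d :
  is_derive x v f d <-> h^-1 *: (f (h *: v + x) - f x) @[h --> 0^'] --> d.
Proof.
split=> [[df <-]|df]; first exact: df.
have dv : derivable f x v by apply/cvg_ex; exists d.
by apply: DeriveDef => //; apply: cvg_lim.
Qed.

Section DirectionalDerivatives.
Context {R : realType} {V : normedModType R}.

Lemma is_derive_line {W : normedModType R} (f : V -> W) x v (s : R) d :
  is_derive (x + s *: v) v f d -> is_derive s 1 (fun t => f (x + t *: v)) d.
Proof.
move=> /is_derive_cvg df.
apply: DeriveDef; last apply: cvg_lim => //; [apply/cvg_ex; exists d|].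
all: apply: cvg_trans df; apply: near_eq_cvg; near=> h; rewrite /=.
all: by congr (_ *: (f _ - _)); rewrite [h *: 1]mulr1 scalerDl addrCA addrC.
Unshelve. all: by end_near. Qed.

Lemma near_continuous (U : set V) (f : V -> R) x e :
  open U -> U x -> {for x, continuous f} -> 0 < e ->
  exists2 d, 0 < d &
    forall y, `|y - x| < d -> U y /\ `|f y - f x| < e.
Proof.
move=> Uo Ux fx e0.
have Un : nbhs x U by apply: open_nbhs_nbhs.
have /cvgrPdist_lt/(_ _ e0) fn := fx.
have /nbhs_normP[d d0 dP] : nbhs x (U `&` [set y | `|f x - f y| < e]).
  by apply: filterI.
exists d => // y yx; have [] := dP y; first by rewrite /= distrC.
by move=> Uy /=; rewrite distrC.
Qed.

(** Parametrizing the segment by [t * b] with [t] in [0, 1] allows [b] of either sign. *)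
Lemma MVT_line (U : set V) (f df : V -> R) y v (b : R) :
  (forall t : R, 0 <= t <= 1 -> U (y + (t * b) *: v)) ->
  (forall z, U z -> is_derive z v f (df z)) ->
  exists2 t : R, 0 <= t <= 1 &
    f (y + b *: v) - f y = b * df (y + (t * b) *: v).
Proof.
move=> Uy fd.
have dphi (t : R) : 0 <= t <= 1 ->
    is_derive t (1 : R) (fun t => f (y + (t * b) *: v)) (df (y + (t * b) *: v) * b).
  move=> t01; have yU := Uy t t01.
  have h : is_derive (t * b : R) (1 : R) (fun s => f (y + s *: v)) (df (y + (t * b) *: v)).
    exact/is_derive_line/fd.
  apply: (@is_derive1_comp _ (fun s => f (y + s *: v)) (fun t => t * b)).
  have -> : (fun t : R => t * b) = b \*: id by apply/funext => k; rewrite mulrC.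
  by apply: is_derive_eq; rewrite /GRing.scale /= mulr1.
have [||t /[!in_itv]/= t01] := @MVT_segment R (fun t => f (y + (t * b) *: v))
    (fun t => df (y + (t * b) *: v) * b) 0 1 ler01.
- by move=> t; rewrite in_itv /= => /andP[t0 t1]; apply: dphi; rewrite !ltW.
- apply: derivable_within_continuous => t; rewrite in_itv /= => t01.
  by case: (dphi t t01).
by rewrite mul1r mul0r scale0r addr0 subr0 mulr1 mulrC => E; exists t.
Qed.

Lemma is_derive_shift (f : V -> R) x v c d :
  is_derive (x + c) v f d -> is_derive x v (fun y => f (y + c)) d.
Proof.
move=> /is_derive_cvg df; apply/is_derive_cvg.
by apply: cvg_trans df; apply: near_eq_cvg; near=> h; rewrite addrA.
Unshelve. all: by end_near. Qed.

(** The mean value theorem is used twice: along [v] for the increment of [f] by [h *: w], then along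
    [w] for [fv]. *)
Lemma second_difference (U : set V) (f fv fvw : V -> R) x v w (h : R) :
  (forall s t : R, 0 <= s <= 1 -> 0 <= t <= 1 ->
     U (x + (s * h) *: v + (t * h) *: w)) ->
  (forall z, U z -> is_derive z v f (fv z)) ->
  (forall z, U z -> is_derive z w fv (fvw z)) ->
  exists s t : R, [/\ 0 <= s <= 1, 0 <= t <= 1 &
    f (x + h *: v + h *: w) - f (x + h *: v) - (f (x + h *: w) - f x) =
    h * (h * fvw (x + (s * h) *: v + (t * h) *: w))].
Proof.
move=> Ux fvP fvwP.
pose U' := [set y | U y /\ U (y + h *: w)].
have [s s01|y [Uy Uyw]|s s01 E] := @MVT_line U' (fun y => f (y + h *: w) - f y)
    (fun y => fv (y + h *: w) - fv y) x v h.
- split; first by have := Ux s 0 s01; rewrite mul0r scale0r addr0; apply; rewrite lexx ler01.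
  by have := Ux s 1 s01; rewrite mul1r; apply; rewrite lexx ler01.
- exact: (is_deriveB (is_derive_shift (fvP _ Uyw)) (fvP _ Uy)).
have [t t01|t t01 E'] := @MVT_line U fv fvw (x + (s * h) *: v) w h _ fvwP.
  exact: Ux.
exists s, t; split=> //.
by rewrite E E'.
Qed.

Lemma eq_near_dist (p q : R) : (forall e, 0 < e -> `|p - q| < e) -> p = q.
Proof.
move=> pq; apply/eqP; rewrite -subr_eq0 -normr_eq0; apply/negPn/negP => h.
by have := pq `|p - q|; rewrite ltxx lt_neqAle eq_sym h normr_ge0 => /(_ isT).
Qed.

(** The second difference is symmetric in [v] and [w], so [fvw] and [fwv] take a common value at two
    points as close to [x] as desired; continuity concludes. *)
Lemma schwarz (U : set V) (f fv fw fvw fwv : V -> R) x v w : open U -> U x ->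
  (forall z, U z -> is_derive z v f (fv z)) ->
  (forall z, U z -> is_derive z w f (fw z)) ->
  (forall z, U z -> is_derive z w fv (fvw z)) ->
  (forall z, U z -> is_derive z v fw (fwv z)) ->
  {for x, continuous fvw} -> {for x, continuous fwv} -> fvw x = fwv x.
Proof.
move=> Uo Ux fvP fwP fvwP fwvP cvw cwv; apply: eq_near_dist => e e0.
have e20 : 0 < e / 2 by rewrite divr_gt0.
have [d1 d10 d1P] := near_continuous Uo Ux cvw e20.
have [d2 d20 d2P] := near_continuous Uo Ux cwv e20.
(* This [h] keeps the whole parallelogram spanned by [h *: v] and [h *: w] within distance [d] of
   [x]. *)
pose d := Num.min d1 d2; pose h := d / (1 + `|v| + `|w|).
have N0 : 0 < 1 + `|v| + `|w| by rewrite -addrA ltr_pwDl // addr_ge0.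
have d0 : 0 < d by rewrite lt_min d10.
have h0 : 0 < h by rewrite divr_gt0.
have close (s t : R) : 0 <= s <= 1 -> 0 <= t <= 1 ->
    `|x + (s * h) *: v + (t * h) *: w - x| < d.
  move=> /andP[s0 s1] /andP[t0 t1].
  rewrite (addrAC _ _ (- x)) (addrAC x) subrr add0r (le_lt_trans (ler_normD _ _)) //.
  rewrite (normrZ (s * h) v) (normrZ (t * h) w) !normrM !ger0_norm // ?(ltW h0) //.
  rewrite (@le_lt_trans _ _ (h * `|v| + h * `|w|)) //.
    by rewrite lerD // ler_wpM2r // ler_piMl // ltW.
  rewrite -mulrDr /h mulrAC ltr_pdivrMr // ltr_pM2l //.
    by rewrite -addrA ltrDr.
  exact: ltW.
have lt1 y : `|y - x| < d -> `|y - x| < d1.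
  by move/lt_le_trans; apply; rewrite ge_min lexx.
have lt2 y : `|y - x| < d -> `|y - x| < d2.
  by move/lt_le_trans; apply; rewrite ge_min lexx orbT.
have Uh (s t : R) : 0 <= s <= 1 -> 0 <= t <= 1 ->
    U (x + (s * h) *: v + (t * h) *: w).
  by move=> s01 t01; have [] := d1P _ (lt1 _ (close s t s01 t01)).
have [s [t [s01 t01 E]]] := second_difference Uh fvP fvwP.
have Uh' (s' t' : R) : 0 <= s' <= 1 -> 0 <= t' <= 1 ->
    U (x + (s' * h) *: w + (t' * h) *: v).
  by move=> s01' t01'; rewrite addrAC; exact: Uh.
have [t' [s' [t01' s01' E']]] := second_difference Uh' fwP fwvP.
have [_ B1] := d1P _ (lt1 _ (close s t s01 t01)).
have [_ B2] := d2P _ (lt2 _ (close s' t' s01' t01')).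
rewrite (addrAC x (h *: w)) (addrAC x ((t' * h) *: w)) in E'.
have EE : fvw (x + (s * h) *: v + (t * h) *: w) =
          fwv (x + (s' * h) *: v + (t' * h) *: w).
  apply: (mulfI (lt0r_neq0 h0)); apply: (mulfI (lt0r_neq0 h0)).
  by rewrite -E -E'; ring.
rewrite -EE in B2.
rewrite -(subrKA (fvw (x + (s * h) *: v + (t * h) *: w))) (le_lt_trans (ler_normD _ _)) //.
by rewrite distrC [ltRHS]splitr ltrD.
Qed.

(** Move first along [v], where the one-variable chain rule applies, then along [w]: by the mean
    value theorem the second increment [H t] is [b t] times a value of [fw] near [x]. *)
Lemma is_derive_curve2 (U : set V) (f fw : V -> R) x v w (a b : R -> R) d a' b' :
  open U -> U x ->
  (forall z, U z -> is_derive z w f (fw z)) -> {for x, continuous fw} ->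
  is_derive x v f d ->
  is_derive 0 (1 : R) a a' -> is_derive 0 (1 : R) b b' -> a 0 = 0 -> b 0 = 0 ->
  is_derive 0 (1 : R) (fun t => f (x + a t *: v + b t *: w)) (a' * d + b' * fw x).
Proof.
move=> Uo Ux fwP cw fvP da db a0 b0.
have cont0 (c : R -> R) c' : is_derive 0 (1 : R) c c' -> {for 0, continuous c}.
  by case=> /derivable1_diffP dc _; exact: differentiable_continuous.
pose H t := f (x + a t *: v + b t *: w) - f (x + a t *: v).
have -> : (fun t => f (x + a t *: v + b t *: w)) =
    ((fun s : R => f (x + s *: v)) \o a) + H.
  by apply/funext => t; rewrite /H /GRing.add /= addrC subrK.
apply: is_deriveD.
  rewrite mulrC; apply: is_derive1_comp; apply: is_derive_line.
  by rewrite a0 scale0r addr0.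
(* The quotient receives its limit [fw x] as value where [b t] vanishes. *)
pose k t := if b t == 0 then fw x else H t / b t.
have kP : k t @[t --> 0] --> fw x.
  apply/cvgrPdist_lt => e e0.
  have [r r0 rP] := near_continuous Uo Ux cw e0.
  have small : \forall t \near 0, `|a t| * `|v| + `|b t| * `|w| < r.
    have : `|a t| * `|v| + `|b t| * `|w| @[t --> 0] --> `|a 0| * `|v| + `|b 0| * `|w|.
      apply: cvgD; apply: cvgMl; apply: cvg_norm.
        exact: (cont0 _ _ da).
      exact: (cont0 _ _ db).
    rewrite a0 b0 normr0 !mul0r addr0 => /cvgrPdist_lt/(_ _ r0).
    apply: filterS => t; rewrite sub0r normrN => /(le_lt_trans _); apply.
    exact: ler_norm.
  near=> t.
  have tr : `|a t| * `|v| + `|b t| * `|w| < r by near: t.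
  rewrite /k; case: eqVneq => [_|bt]; first by rewrite subrr normr0.
  have close (s : R) : 0 <= s <= 1 -> `|x + a t *: v + (s * b t) *: w - x| < r.
    move=> /andP[s0 s1]; apply: le_lt_trans tr.
    rewrite (addrAC _ _ (- x)) (addrAC x) subrr add0r (le_trans (ler_normD _ _)) //.
    rewrite (normrZ _ v) (normrZ _ w) lerD // ler_wpM2r // normrM ler_piMl //.
    by rewrite ger0_norm.
  have [s s01|s s01 E] := @MVT_line U f fw (x + a t *: v) w (b t) _ fwP.
    by have [] := rP _ (close s s01).
  rewrite /H E mulrAC divff // mul1r distrC.
  by have [] := rP _ (close s s01).
apply/is_derive_cvg.
have /is_derive_cvg db' := db.
have : (h^-1 *: (b (h *: 1 + 0) - b 0)) * k h @[h --> 0^'] --> b' * fw x.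
  by apply: cvgM => //; apply: cvg_within_filter kP.
apply: cvg_trans; apply: near_eq_cvg; near=> h.
rewrite /H a0 b0 !scale0r !addr0 subrr !subr0 /k /H.
rewrite [h *: 1]mulr1.
case: eqVneq => [->|bh]; first by rewrite scaler0 scale0r addr0 subrr mul0r scaler0.
by rewrite /GRing.scale /= -mulrA [b h * _]mulrC divfK.
Unshelve. all: by end_near. Qed.

End DirectionalDerivatives.

(** * Matrix-valued maps of class C^1 and C^2 *)

Section MatrixValued.
Context {R : realType} {V : normedModType R} {m n : nat}.
Implicit Types (g : V -> 'M[R]_(m, n)) (x v w : V).

Lemma is_derive_mxP g x v d :
  is_derive x v g d <->
  forall i j, is_derive x v (fun y => g y i j) (d i j).
Proof.
split=> [[dg <-] i j|dg].
  have dgij := (derivable_mxP g x v).1 dg i j.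
  by apply: DeriveDef => //; rewrite derive_mx // mxE.
have dg' : derivable g x v by apply/derivable_mxP => i j; case: (dg i j).
apply: DeriveDef => //; rewrite derive_mx //.
by apply/matrixP => i j; rewrite mxE; case: (dg i j).
Qed.

Lemma continuous_coord g x i j :
  {for x, continuous g} -> {for x, continuous (fun y => g y i j)}.
Proof.
move=> cg; apply: (@continuous_comp _ _ _ g (fun M => M i j)) => //.
exact: coord_continuous.
Qed.

End MatrixValued.

Section ContinuouslyDifferentiable.
Context {R : realType} {V : normedModType R} {m n : nat}.
Context (U : set V) (Uo : open U).
Implicit Types (g : V -> 'M[R]_(m, n)) (x v w : V).

Lemma Ck1_curve2 g x v w (a b : R -> R) a' b' : U x -> is_Ck 1 U g ->
  is_derive 0 (1 : R) a a' -> is_derive 0 (1 : R) b b' -> a 0 = 0 -> b 0 = 0 ->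
  is_derive 0 (1 : R) (fun t => g (x + a t *: v + b t *: w))
    (a' *: 'D_v g x + b' *: 'D_w g x).
Proof.
move=> Ux [_ gC] da db a0 b0; apply/is_derive_mxP => i j; rewrite !mxE.
have gd z : U z -> forall u, is_derive z u (fun y => g y i j) ('D_u g z i j).
  move=> Uz u; apply: ((is_derive_mxP _ _ _ _).1 _ i j).
  by apply/derivableP; case: (gC u) => /(_ z Uz).
apply: (is_derive_curve2 Uo Ux (fun z Uz => gd z Uz w)) => //; last exact: gd.
by apply: continuous_coord; case: (gC w) => _ [/(_ x Ux)].
Qed.

Lemma Ck1_derive g x v : U x -> is_Ck 1 U g -> is_derive x v g ('D_v g x).
Proof. by move=> Ux [_ /(_ v)[/(_ x Ux) dg _]]; exact: derivableP. Qed.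

(** Differentiate [g] along the line of direction [p *: v + q *: w] in two ways: directly, and by
    the chain rule [Ck1_curve2]. *)
Lemma Ck1_derive_lin g x v w (p q : R) : U x -> is_Ck 1 U g ->
  'D_(p *: v + q *: w) g x = p *: 'D_v g x + q *: 'D_w g x.
Proof.
move=> Ux gC.
have lin (r : R) : is_derive 0 (1 : R) (fun t => t * r) r.
  have -> : (fun t : R => t * r) = r \*: id by apply/funext => k; rewrite mulrC.
  by apply: is_derive_eq; rewrite /GRing.scale /= mulr1.
have := Ck1_curve2 v w Ux gC (lin p) (lin q) (mul0r _) (mul0r _).
have H : is_derive 0 (1 : R) (fun t => g (x + t *: (p *: v + q *: w)))
    ('D_(p *: v + q *: w) g x).
  apply: is_derive_line; rewrite scale0r addr0; exact: Ck1_derive.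
have -> : (fun t => g (x + (t * p) *: v + (t * q) *: w)) =
   (fun t => g (x + t *: (p *: v + q *: w))).
  by apply/funext => t; rewrite scalerDr !scalerA addrA.
by case: H => _ <- [_ <-].
Qed.

Lemma Ck2_schwarz g x v w : U x -> is_Ck 2 U g ->
  'D_v ('D_w g) x = 'D_w ('D_v g) x.
Proof.
move=> Ux gC; have [_ gC2] := gC.
have gd z u : U z -> is_derive z u g ('D_u g z).
  by move=> Uz; apply/derivableP; case: (gC2 u) => /(_ z Uz).
have gdd z u u' : U z -> is_derive z u' ('D_u g) ('D_u' ('D_u g) z).
  move=> Uz; apply: Ck1_derive => //; by case: (gC2 u).
have gc u u' : {for x, continuous ('D_u' ('D_u g))}.
  by case: (gC2 u) => _ [_ /(_ u')[_ [/(_ x Ux)]]].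
apply/matrixP => i j.
have d1 u z : U z -> is_derive z u (fun y => g y i j) ('D_u g z i j).
  by move=> Uz; exact: ((is_derive_mxP _ _ _ _).1 (gd _ _ Uz) i j).
have d2 u u' z : U z ->
    is_derive z u' (fun y => 'D_u g y i j) ('D_u' ('D_u g) z i j).
  by move=> Uz; exact: ((is_derive_mxP _ _ _ _).1 (gdd _ _ _ Uz) i j).
apply: (schwarz Uo Ux (d1 w) (d1 v) (d2 w v) (d2 v w)); exact: continuous_coord.
Qed.

End ContinuouslyDifferentiable.

(** * The group Spin(6), its action on R^6, and rotors *)

Section SpinGroup.
Context {R : realType}.
Implicit Types (x y z : 'cV[R]_5) (v w : 'rV[R]_6) (u h : 'M[R]_8).

Local Notation g0 := (gamma ord0 : 'M[R]_8).
Local Notation E0 := (delta_mx 0 ord0 : 'rV[R]_6).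

Lemma dotC v w : dot v w = dot w v.
Proof. by apply: eq_bigr => i _; rewrite mulrC. Qed.

Lemma dotDl v w (z : 'rV[R]_6) : dot (v + w) z = dot v z + dot w z.
Proof. by rewrite -big_split; apply: eq_bigr => i _; rewrite mxE mulrDl. Qed.

Lemma dotZl (a : R) v w : dot (a *: v) w = a * dot v w.
Proof. by rewrite mulr_sumr; apply: eq_bigr => i _; rewrite mxE mulrA. Qed.

Lemma dotDr v w (z : 'rV[R]_6) : dot v (w + z) = dot v w + dot v z.
Proof. by rewrite dotC dotDl !(dotC v). Qed.

Lemma dotZr (a : R) v w : dot v (a *: w) = a * dot v w.
Proof. by rewrite dotC dotZl (dotC v). Qed.

Lemma dotNr v w : dot v (- w) = - dot v w.
Proof. by rewrite -scaleN1r dotZr mulN1r. Qed.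

Lemma dot_eq0 v : dot v v = 0 -> v = 0.
Proof.
move=> /eqP; rewrite psumr_eq0 => [/allP v0|i _]; last by rewrite -expr2 sqr_ge0.
apply/rowP => i; rewrite mxE; apply/eqP.
by have := v0 i (mem_index_enum _); rewrite /= mulf_eq0 orbb.
Qed.

Lemma cliff_inj v w : cliff v = cliff w -> v = w.
Proof.
move=> vw; apply/eqP; rewrite -subr_eq0; apply/eqP/dot_eq0.
have := cliff_clifford (v - w) (v - w).
rewrite cliffB vw subrr mul0r addr0 => /matrixP/(_ 0 0).
rewrite !mxE /= mulr1n => /eqP; rewrite eq_sym oppr_eq0 mulf_eq0 pnatr_eq0 /=.
by move/eqP.
Qed.

Lemma cliff_unitmx v : sphere v -> cliff v \in unitmx.
Proof.
move=> v1; have /mulmx1_unit[] // := cliff_unit v1.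
Qed.

Lemma even_unit_products_mul P u h :
  even_unit_products P u -> even_unit_products P h -> even_unit_products P (u *m h).
Proof.
move=> [s [s1 s2 ->]] [r [r1 r2 ->]]; exists (s ++ r); split.
- by move=> v; rewrite mem_cat => /orP[/s1|/r1].
- by rewrite size_cat oddD (negbTE s2) (negbTE r2).
- by rewrite big_cat.
Qed.

Lemma even_unit_products_unitmx P u : even_unit_products P u -> u \in unitmx.
Proof.
move=> [s [s1 _ ->]]; rewrite big_seq.
suff : (\prod_(v <- s | v \in s) cliff v) \is a GRing.unit by [].
apply: rpred_prod => v vs.
by apply: cliff_unitmx; case: (s1 v vs).
Qed.

Lemma even_unit_products_pair P v w : sphere v -> sphere w -> P v -> P w ->
  even_unit_products P (cliff v *m cliff w).
Proof.
move=> v1 w1 Pv Pw; exists [:: v; w]; split=> //.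
  by move=> z; rewrite !inE => /orP[] /eqP ->.
by rewrite big_cons big_seq1.
Qed.

Lemma Spin6_1 : Spin6 (1 : 'M[R]_8).
Proof. by exists [::]; split=> //; rewrite big_nil. Qed.

Lemma covering_lin u (a b : R) v w : Spin6 u ->
  covering u (a *: v + b *: w) = a *: covering u v + b *: covering u w.
Proof.
move=> uS; apply: cliff_inj; rewrite cliffD !cliffZ !coveringP //.
by rewrite cliffD !cliffZ mulmxDr mulmxDl -!scalemxAr -!scalemxAl.
Qed.

(** Conjugation by [u] preserves Clifford products, and the scalar in the Clifford relation commutes
    with [u]. *)
Lemma dot_covering u v w : Spin6 u -> dot (covering u v) (covering u w) = dot v w.
Proof.
move=> uS; have uU := even_unit_products_unitmx uS.
have := cliff_clifford (covering u v) (covering u w).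
have E p q : cliff (covering u p) * cliff (covering u q) =
    u *m (cliff p *m cliff q) *m invmx u.
  by rewrite -mulmxE !coveringP // !mulmxA mulmxKV.
rewrite !E -mulmxDl -mulmxDr [X in u *m X](cliff_clifford v w).
rewrite mul_mx_scalar -scalemxAl mulmxV // scalemx1 => /matrixP/(_ 0 0).
rewrite !mxE /= !mulr1n; lra.
Qed.

Lemma covering_mul u h v : Spin6 u -> Spin6 h ->
  covering (u *m h) v = covering u (covering h v).
Proof.
move=> uS hS; have uhS := even_unit_products_mul uS hS.
apply: cliff_inj; rewrite !coveringP //.
have -> : invmx (u *m h) = invmx h *m invmx u.
  exact: (invrM (even_unit_products_unitmx uS) (even_unit_products_unitmx hS)).
by rewrite !mulmxA.
Qed.

(* The horizontal curves of the frame bundle are [u *m rotor x (al t) (be t)]: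
   along them the frame is parallel, and the base point moves with velocity
   [2 *: covering u (emb x)] where [al = 1] and [be' = 1]. *)
Definition rotor x (al be : R) : 'M[R]_8 := al%:M + be *: (g0 *m cl x).

Lemma sphere_E0 : sphere E0.
Proof.
rewrite /sphere /= /dot (bigD1 ord0) //= big1 ?addr0 ?mxE ?eqxx ?mulr1 // => i i0.
by rewrite mxE (negbTE i0) andbF mul0r.
Qed.

Lemma dot_E0 v : dot E0 v = v 0 0.
Proof.
rewrite /dot (bigD1 ord0) //= big1 ?addr0 => [|i i0].
  by rewrite mxE !eqxx mul1r.
by rewrite mxE (negbTE i0) andbF mul0r.
Qed.

Section Rotor.
Context (x : 'cV[R]_5) (al be : R) (al_be : al ^+ 2 + be ^+ 2 * ip x x = 1).

Let y : 'rV[R]_6 := (- al) *: E0 + be *: emb x.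

Let y1 : sphere y.
Proof.
rewrite /sphere /= /y !(dotDl, dotDr, dotZl, dotZr) (dotC _ E0) !dot_E0 emb0.
rewrite mxE !eqxx /= dot_emb -/(ip x x) -[RHS]al_be; ring.
Qed.

(** As e_0 squares to -1, its product with [y] has scalar part [al]; the hypothesis on [al] and [be]
    makes [y] a unit vector. *)
Lemma rotorE : rotor x al be = cliff E0 *m cliff y.
Proof.
rewrite /y cliffD !cliffZ cliff_delta mulmxDr -!scalemxAr gamma_sqr.
by rewrite scaleNr scalerN opprK -/(cl x) /rotor scalemx1.
Qed.

Lemma Spin6_rotor : Spin6 (rotor x al be).
Proof.
by rewrite rotorE; apply: even_unit_products_pair => //; exact: sphere_E0.
Qed.

(** Apply [conj_unit] twice, first to [y] and then to e_0. *)
Lemma covering_rotor v : covering (rotor x al be) v =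
  (2 * dot E0 ((2 * dot y v) *: y - v)) *: E0 - ((2 * dot y v) *: y - v).
Proof.
apply: cliff_inj; rewrite coveringP; last exact: Spin6_rotor.
rewrite -(conj_unit _ sphere_E0) -(conj_unit _ y1) rotorE.
have inv (z : 'rV[R]_6) : sphere z -> invmx (cliff z) = - cliff z.
  move=> z1; have U := cliff_unitmx z1.
  by apply: (can_inj (mulKmx U)); rewrite mulmxV // [RHS]cliff_unit.
have -> : invmx (cliff E0 *m cliff y) = - cliff y *m - cliff E0.
  rewrite -!inv //; last exact: sphere_E0.
  exact: (invrM (cliff_unitmx sphere_E0) (cliff_unitmx y1)).
by rewrite -!mulmxE !mulmxA.
Qed.

Let dot_E0y : dot E0 y = - al.
Proof. by rewrite /y dotDr !dotZr !dot_E0 emb0 mxE !eqxx /=; ring. Qed.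

Lemma covering_rotor_E0 :
  covering (rotor x al be) E0 = (2 * al ^+ 2 - 1) *: E0 + (2 * al * be) *: emb x.
Proof.
rewrite covering_rotor.
rewrite [dot y E0]dotC dotDr dotNr dotZr dot_E0y dot_E0 mxE !eqxx.
by apply/rowP => i; rewrite /y !mxE /=; ring.
Qed.

Lemma covering_rotor_emb z : covering (rotor x al be) (emb z) =
  emb z + (- 2 * be * ip x z) *: (al *: E0 + be *: emb x).
Proof.
rewrite covering_rotor.
have -> : dot y (emb z) = be * ip x z.
  by rewrite dotDl !dotZl dot_E0 emb0 dot_emb -/(ip x z); ring.
rewrite dotDr dotNr dotZr dot_E0y dot_E0 emb0.
by apply/rowP => i; rewrite /y !mxE /=; ring.
Qed.

End Rotor.

Lemma delta_lift (i : 'I_5) :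
  delta_mx 0 (lift ord0 i) = emb (delta_mx i 0) :> 'rV[R]_6.
Proof.
apply/rowP => k; rewrite !mxE eqxx /=; case: unliftP => [j|] -> //.
by rewrite !mxE (inj_eq lift_inj) eqxx andbT.
Qed.

Lemma frameE u i : frame u i = covering u (emb (delta_mx i 0)).
Proof. by rewrite /frame delta_lift. Qed.

Lemma rotor0 x : rotor x 1 0 = 1.
Proof. by rewrite /rotor scale0r addr0. Qed.

Lemma rotor_curve x : exists al be : R -> R,
  [/\ al 0 = 1 /\ be 0 = 0, is_derive 0 (1 : R) al 0, is_derive 0 (1 : R) be 1 &
      forall t, al t ^+ 2 + be t ^+ 2 * ip x x = 1].
Proof.
have [x0|x0] := eqVneq (ip x x) 0.
  exists (cst 1), id; split; [by []|exact: is_derive_cst|exact: is_derive_id|].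
  by move=> t; rewrite /= x0 mulr0 addr0 expr1n.
pose r := Num.sqrt (ip x x).
have r2 : r ^+ 2 = ip x x by rewrite sqr_sqrtr // ip_ge0.
have r0 : r != 0 by rewrite -sqrf_eq0 r2.
have dr : is_derive 0 (1 : R) (fun t => t * r) r.
  have -> : (fun t : R => t * r) = r \*: id by apply/funext => k; rewrite mulrC.
  by apply: is_derive_eq; rewrite /GRing.scale /= mulr1.
exists (cos \o (fun t => t * r)), (r^-1 \*: (sin \o (fun t => t * r))); split.
- by rewrite /= mul0r cos0 sin0 scaler0.
- have : is_derive (0 * r : R) (1 : R) cos (- sin (0 * r)) by exact: is_derive_cos.
  by move=> cd; have := @is_derive1_comp _ cos (fun t => t * r) 0 _ _ cd dr;
    rewrite mul0r sin0 oppr0 mul0r.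
- have : is_derive (0 * r : R) (1 : R) sin (cos (0 * r)) by exact: is_derive_sin.
  move=> sd; have := @is_derive1_comp _ sin (fun t => t * r) 0 _ _ sd dr.
  rewrite mul0r cos0 mul1r => ds.
  by apply: is_derive_eq; rewrite /GRing.scale /= mulVf.
- move=> t; rewrite -r2 /= /GRing.scale /= exprMn exprVn mulrAC mulVf ?expf_neq0 //.
  by rewrite mul1r cos2Dsin2.
Qed.

End SpinGroup.

(** * Derivatives along rotor curves *)

Section Curves.
Context {R : realType}.

Lemma is_derive_comb m n (s : R) (a b : R -> R) a' b' (P M N : 'M[R]_(m, n)) :
  is_derive s (1 : R) a a' -> is_derive s (1 : R) b b' ->
  is_derive s (1 : R) (fun t => P + a t *: M + b t *: N) (a' *: M + b' *: N).
Proof.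
move=> da db; apply/is_derive_mxP => i j.
have -> : (fun t => (P + a t *: M + b t *: N) i j) =
    cst (P i j) + (M i j \*: a) + (N i j \*: b).
  by apply/funext => t; rewrite !mxE; congr (_ + _ + _); exact: mulrC.
by apply: is_derive_eq; rewrite add0r !mxE /GRing.scale /= (mulrC a') (mulrC b').
Qed.

Context (u : 'M[R]_8) (B : 'M[R]_8) (al be : R -> R).
Context (al0 : al 0 = 1) (be0 : be 0 = 0).
Context (dal : is_derive 0 (1 : R) al 0) (dbe : is_derive 0 (1 : R) be 1).

(** The two coefficients on the right vanish at 0, as [Ck1_curve2] requires. *)
Lemma rotor_curveE t : u *m ((al t)%:M + be t *: B) =
  u + (al t - 1) *: u + be t *: (u *m B).
Proof.
rewrite mulmxDr mul_mx_scalar -scalemxAr; congr (_ + _).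
by rewrite scalerBl scale1r addrC subrK.
Qed.

Let dal1 : is_derive 0 (1 : R) (fun t => al t - 1) 0.
Proof. by apply: is_derive_eq; rewrite subr0. Qed.

Lemma is_derive_rotor_curve :
  is_derive 0 (1 : R) (fun t => u *m ((al t)%:M + be t *: B)) (u *m B).
Proof.
have -> : (fun t => u *m ((al t)%:M + be t *: B)) =
  (fun t => u + (al t - 1) *: u + be t *: (u *m B)).
  by apply/funext => t; exact: rotor_curveE.
have := is_derive_comb u u (u *m B) dal1 dbe.
by rewrite scale0r add0r scale1r.
Qed.

Lemma near_rotor_curve (U : set 'M[R]_8) : open U -> U u ->
  \forall t \near 0, U (u *m ((al t)%:M + be t *: B)).
Proof.
move=> Uo Uu; have [/derivable1_diffP/differentiable_continuous c _] := is_derive_rotor_curve.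
apply: c; rewrite al0 be0 scale0r addr0 mulmx1; exact: open_nbhs_nbhs.
Qed.

Lemma Ck1_rotor_curve m n (U : set 'M[R]_8) (h : 'M[R]_8 -> 'M[R]_(m, n)) :
  open U -> U u -> is_Ck 1 U h ->
  is_derive 0 (1 : R) (fun t => h (u *m ((al t)%:M + be t *: B)))
    ('D_(u *m B) h u).
Proof.
move=> Uo Uu hC.
have -> : (fun t => h (u *m ((al t)%:M + be t *: B))) =
  (fun t => h (u + (al t - 1) *: u + be t *: (u *m B))).
  by apply/funext => t; rewrite rotor_curveE.
have := Ck1_curve2 Uo u (u *m B) Uu hC dal1 dbe.
by rewrite scale0r add0r scale1r; apply=> //; rewrite al0 subrr.
Qed.

End Curves.

(** * The Killing equation along horizontal curves *)

Section KillingSpinor.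
Context {R : realType} (Psi : 'M[R]_8 -> 'cV[R]_8) (A : 'rV[R]_6 -> 'M[R]_6).
Context (killing : generalized_killing_spinor Psi A).
Implicit Types (x y : 'cV[R]_5) (u : 'M[R]_8).
Local Notation g0 := (gamma ord0 : 'M[R]_8).
Local Notation E0 := (delta_mx 0 ord0 : 'rV[R]_6).

(** The matrix of [A] in the frame of [u]: column [j] holds the coordinates of the image of
    [frame u j]. *)
Definition endo (A : 'rV[R]_6 -> 'M[R]_6) u : 'M[R]_5 :=
  \matrix_(k, j) dot (frame u j *m A (base_pt u)) (frame u k).

Lemma sphere_base_pt u : Spin6 u -> sphere (base_pt u).
Proof. by move=> uS; rewrite /sphere /= dot_covering //; exact: sphere_E0. Qed.

Lemma tangent_covering u x : Spin6 u -> tangent (base_pt u) (covering u (emb x)).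
Proof. by move=> uS; rewrite /tangent /= dot_covering // dot_E0 emb0. Qed.

Lemma endo_sym u : Spin6 u -> (endo A u)^T = endo A u.
Proof.
move=> uS; case: killing => _ _ [_ As] _.
have [_ sym] := As _ (sphere_base_pt uS).
apply/matrixP => k j; rewrite mxE ![endo _ _ _ _]mxE sym; first exact: dotC.
  by rewrite frameE; exact: tangent_covering.
by rewrite frameE; exact: tangent_covering.
Qed.

Lemma covering_embE u x : Spin6 u ->
  covering u (emb x) = \sum_k x k 0 *: frame u k.
Proof.
move=> uS.
have c0 : covering u 0 = 0.
  by have := @covering_lin _ u 0 0 0 0 uS; rewrite !scale0r addr0.
have cD : {morph covering u : v w / v + w}.
  by move=> v w; rewrite -[v in LHS]scale1r -[w in LHS]scale1r covering_lin // !scale1r.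
have cZ a v : covering u (a *: v) = a *: covering u v.
  by have := @covering_lin _ u a 0 v 0 uS; rewrite !scale0r !addr0.
have -> : emb x = \sum_k x k 0 *: emb (delta_mx k 0).
  apply/rowP => i; rewrite mxE summxE; case: unliftP => [j|] ->.
    rewrite (bigD1 j) //= big1 ?addr0 => [|k kj].
      by rewrite mxE embS mxE !eqxx mulr1.
    by rewrite mxE embS mxE eq_sym (negbTE kj) mulr0.
  by rewrite big1 // => k _; rewrite mxE emb0 mulr0.
by rewrite (big_morph (covering u) cD c0); apply: eq_bigr => k _; rewrite cZ -frameE.
Qed.

Lemma endoE u x j : Spin6 u ->
  dot (covering u (emb x) *m A (base_pt u)) (frame u j) = (endo A u *m x) j 0.
Proof.
move=> uS; rewrite covering_embE // mulmx_suml mxE.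
rewrite /dot; under eq_bigr do rewrite summxE mulr_suml.
rewrite exchange_big; apply: eq_bigr => k _ /=.
rewrite mxE /dot mulr_suml; apply: eq_bigr => i _.
by rewrite -scalemxAl !mxE; ring.
Qed.

Lemma clifford_mul_endo u x psi : Spin6 u ->
  clifford_mul u (covering u (emb x) *m A (base_pt u)) psi =
  cl (endo A u *m x) *m psi.
Proof.
move=> uS; rewrite clE mulmx_suml; apply: eq_bigr => j _.
by rewrite -scalemxAl endoE.
Qed.

Lemma base_pt_rotor u x al be : Spin6 u -> al ^+ 2 + be ^+ 2 * ip x x = 1 ->
  base_pt (u *m rotor x al be) =
  (2 * al ^+ 2 - 1) *: base_pt u + (2 * al * be) *: covering u (emb x).
Proof.
move=> uS ab; rewrite /base_pt covering_mul //; last exact: Spin6_rotor.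
by rewrite covering_rotor_E0 // covering_lin.
Qed.

Lemma frame_rotor u x al be k : Spin6 u -> al ^+ 2 + be ^+ 2 * ip x x = 1 ->
  frame (u *m rotor x al be) k =
  frame u k + (- 2 * be * x k 0 * al) *: base_pt u
    + (- 2 * be * x k 0 * be) *: covering u (emb x).
Proof.
move=> uS ab; rewrite !frameE covering_mul //; last exact: Spin6_rotor.
rewrite covering_rotor_emb //.
have -> : ip x (delta_mx k 0) = x k 0.
  by rewrite ipC /ip trmx_delta -rowE mxE.
rewrite -[emb (delta_mx k 0)]scale1r covering_lin // covering_lin // !scale1r.
by rewrite scalerDr !scalerA addrA.
Qed.

(** The base point moves with velocity twice [covering u (emb x)], hence the factor 2; the
    connection terms vanish. *)
Lemma killing_curve u x (al be : R -> R) : Spin6 u -> al 0 = 1 -> be 0 = 0 ->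
  is_derive 0 (1 : R) al 0 -> is_derive 0 (1 : R) be 1 ->
  (forall t, al t ^+ 2 + be t ^+ 2 * ip x x = 1) ->
  derive1 (fun t => Psi (u *m rotor x (al t) (be t))) 0 =
  2 *: (cl (endo A u *m x) *m Psi u).
Proof.
move=> uS al0 be0 dal dbe ab; case: killing => _ _ _ K.
pose X := covering u (emb x).
have tX : tangent (base_pt u) (2 *: X).
  by rewrite /tangent /= dotZr tangent_covering // mulr0.
have := K u (2 *: X) uS tX (fun t => u *m rotor x (al t) (be t)).
rewrite /nabla_along al0 be0 rotor0 mulmx1.
have -> : clifford_mul u ((2 *: X) *m A (base_pt u)) (Psi u) =
    2 *: (cl (endo A u *m x) *m Psi u).
  rewrite /X -clifford_mul_endo // /clifford_mul scaler_sumr.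
  by apply: eq_bigr => j _; rewrite -scalemxAl dotZl scalerA.
have dcst (f : R -> R) f' : is_derive 0 (1 : R) f f' -> derive1 f 0 = f'.
  by case=> _ <-; rewrite derive1E.
(* At time 0 the frame vectors move in the direction of [base_pt u], which is orthogonal to the
   frame. *)
rewrite big1 => [|i _]; last first.
  rewrite big1 // => j _.
  have -> : (fun t => frame (u *m rotor x (al t) (be t)) i) = (fun t => frame u i +
    (- 2 * be t * x i 0 * al t) *: base_pt u + (- 2 * be t * x i 0 * be t) *: X).
    by apply/funext => t; rewrite frame_rotor.
  have d1 : is_derive 0 (1 : R) (fun t => - 2 * be t * x i 0 * al t) (- 2 * x i 0).
    have -> : (fun t => - 2 * be t * x i 0 * al t) = (- 2 * x i 0) \*: (be * al).
      by apply/funext => t; rewrite -[RHS]/(- 2 * x i 0 * (be t * al t)); ring.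
    by apply: is_derive_eq; rewrite be0 al0 /GRing.scale /=; ring.
  have d2 : is_derive 0 (1 : R) (fun t => - 2 * be t * x i 0 * be t) 0.
    have -> : (fun t => - 2 * be t * x i 0 * be t) = (- 2 * x i 0) \*: (be * be).
      by apply/funext => t; rewrite -[RHS]/(- 2 * x i 0 * (be t * be t)); ring.
    by apply: is_derive_eq; rewrite be0 /GRing.scale /=; ring.
  have [_] := is_derive_comb (frame u i) (base_pt u) X d1 d2.
  rewrite derive1E => ->.
  by rewrite scale0r addr0 dotZl frameE tangent_covering // mulr0 scale0r.
rewrite scaler0 addr0; apply.
- by move=> t; apply: even_unit_products_mul => //; exact: Spin6_rotor.
- by case: (is_derive_rotor_curve u (g0 *m cl x) dal dbe).
- by [].
- have -> : (fun t => base_pt (u *m rotor x (al t) (be t))) = (fun t => 0 +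
    (2 * al t ^+ 2 - 1) *: base_pt u + (2 * al t * be t) *: X).
    by apply/funext => t; rewrite base_pt_rotor // add0r.
  have d1 : is_derive 0 (1 : R) (fun t => 2 * al t ^+ 2 - 1) 0.
    have -> : (fun t => 2 * al t ^+ 2 - 1) = (2 \*: (al * al)) - cst 1.
      by apply/funext => t; rewrite expr2.
    by apply: is_derive_eq; rewrite al0 /GRing.scale /=; ring.
  have d2 : is_derive 0 (1 : R) (fun t => 2 * al t * be t) 2.
    have -> : (fun t => 2 * al t * be t) = 2 \*: (al * be).
      by apply/funext => t; rewrite -mulrA.
    by apply: is_derive_eq; rewrite al0 be0 /GRing.scale /=; ring.
  have [_] := is_derive_comb 0 (base_pt u) X d1 d2.
  by rewrite derive1E => ->; rewrite scale0r add0r.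
Qed.

End KillingSpinor.

(** * Functions on Spin(6) with vanishing horizontal derivatives are constant *)

Section Connectedness.
Context {R : realType}.
Implicit Types (x y : 'cV[R]_5) (u : 'M[R]_8).
Local Notation g0 := (gamma ord0 : 'M[R]_8).

Lemma cl_sqr x : cl x *m cl x = (- ip x x)%:M.
Proof.
have := cl_clifford x x; rewrite -/(ip x x) => h.
have two0 : (2 : R) != 0 by rewrite pnatr_eq0.
apply: (scalerI two0); rewrite scaler_nat mulr2n h scale_scalar_mx.
by rewrite mulrN.
Qed.

Lemma g0cl_sqr x : (g0 *m cl x) *m (g0 *m cl x) = (- ip x x)%:M.
Proof.
rewrite {1}g0_cl mulNmx mulmxA -(mulmxA (cl x)) g0_sqr mulmxN mulmx1 mulNmx opprK.
exact: cl_sqr.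
Qed.

Lemma rotorD x (s t : R) : ip x x = 1 ->
  rotor x (cos (s + t)) (sin (s + t)) =
  rotor x (cos s) (sin s) *m rotor x (cos t) (sin t).
Proof.
move=> x1; rewrite /rotor mulmxDl !mulmxDr -!scalemxAl -!scalemxAr g0cl_sqr x1.
rewrite !mul_mx_scalar !mul_scalar_mx cosD sinD; move: (g0 *m cl x) => B.
by apply/matrixP => i j; rewrite !mxE /=; case: (i == j); rewrite ?mulr1n ?mulr0n; ring.
Qed.

Lemma sphere_split v :
  v = v 0 0 *: delta_mx 0 ord0 + emb (\col_i v 0 (lift ord0 i)) :> 'rV[R]_6.
Proof.
apply/rowP => i; rewrite !mxE eqxx /=; case: unliftP => [j|] ->.
  by rewrite mxE mulr0 add0r.
by rewrite eqxx mulr1 addr0.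
Qed.

Lemma sphere_split_norm (v : 'rV[R]_6) : sphere v ->
  v 0 0 ^+ 2 + ip (\col_i v 0 (lift ord0 i)) (\col_i v 0 (lift ord0 i)) = 1.
Proof.
rewrite /sphere /= => v1; rewrite -[RHS]v1.
have := sphere_split v; set x := \col__ _; set e := v 0 0 => ->.
rewrite !(dotDl, dotDr, dotZl, dotZr) dot_emb (dotC (emb _)) !dot_E0 emb0 -/(ip _ _).
by rewrite mxE !eqxx /=; ring.
Qed.

Section Constant.
Context (F : 'M[R]_8 -> R).
Context (F0 : forall u x (al be : R -> R), Spin6 u -> al 0 = 1 -> be 0 = 0 ->
  is_derive 0 (1 : R) al 0 -> is_derive 0 (1 : R) be 1 ->
  (forall t, al t ^+ 2 + be t ^+ 2 * ip x x = 1) ->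
  is_derive 0 (1 : R) (fun t => F (u *m rotor x (al t) (be t))) 0).

(** By [rotorD] the curve is a coset of a one-parameter group, so [F0] at time 0, applied at each of
    its points, gives a zero derivative at every time. *)
Let const_trig u x t : Spin6 u -> ip x x = 1 ->
  F (u *m rotor x (cos t) (sin t)) = F u.
Proof.
move=> uS x1; pose phi s := F (u *m rotor x (cos s) (sin s)).
have -> : F u = phi 0 by rewrite /phi cos0 sin0 rotor0 mulmx1.
apply: (@is_derive_0_is_cst _ phi) => s.
have sS : Spin6 (u *m rotor x (cos s) (sin s)).
  apply: even_unit_products_mul => //; apply: Spin6_rotor.
  by rewrite x1 mulr1 cos2Dsin2.
have dc : is_derive (0 : R) (1 : R) cos 0 by apply: is_derive_eq; rewrite sin0 oppr0.
have ds : is_derive (0 : R) (1 : R) sin 1 by apply: is_derive_eq; rewrite cos0.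
have := F0 sS (@cos0 R) (@sin0 R) dc ds.
move=> /(_ x) d; apply/is_derive_cvg.
have {}d : is_derive (0 : R) (1 : R)
    (fun t => F (u *m rotor x (cos s) (sin s) *m rotor x (cos t) (sin t))) 0.
  by apply: d => k; rewrite x1 mulr1 cos2Dsin2.
move/is_derive_cvg: d; apply: cvg_trans; apply: near_eq_cvg; near=> h.
by rewrite /phi -!mulmxA -!rotorD // !addr0 (addrC s).
Unshelve. all: by end_near. Qed.

Let const_rotor u x (al : R) : Spin6 u -> al ^+ 2 + ip x x = 1 ->
  F (u *m rotor x al 1) = F u.
Proof.
move=> uS ax.
pose r := Num.sqrt (ip x x).
have r2 : r ^+ 2 = ip x x by rewrite sqr_sqrtr // ip_ge0.
have [y [y1 yx]] : exists y, ip y y = 1 /\ r *: y = x.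
  have [x0|x0] := eqVneq x 0.
    exists (delta_mx 0 0); split; first by rewrite /ip trmx_delta -rowE !mxE !eqxx.
    by rewrite /r x0 ip0r sqrtr0 scale0r.
  have r0 : r != 0 by rewrite -sqrf_eq0 r2 ip_eq0.
  exists (r^-1 *: x); split; last by rewrite scalerA divff // scale1r.
  by rewrite ipZl ipZr -r2; field.
have al1 : -1 <= al <= 1.
  by rewrite -ler_norml -(@ler_pXn2r _ 2) ?nnegrE // expr1n
    real_normK ?num_real // -ax lerDl ip_ge0.
have -> : rotor x al 1 = rotor y (cos (acos al)) (sin (acos al)).
  rewrite acosK ?in_itv //= sin_acos //.
  have -> : 1 - al ^+ 2 = ip x x by rewrite -ax addrC addKr.
  by rewrite /rotor -/r scale1r -[X in cl X]yx clZ -scalemxAr.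
exact: const_trig.
Qed.

(** Inserting [- g0 *m g0 = 1] between the two unit vectors splits their product into two rotors. *)
Let const_cliff u v w : Spin6 u -> sphere v -> sphere w ->
  F (u *m (cliff v *m cliff w)) = F u.
Proof.
move=> uS v1 w1.
have -> : cliff v *m cliff w = rotor (\col_i v 0 (lift ord0 i)) (v 0 0) 1 *m
   rotor (\col_i w 0 (lift ord0 i)) (- w 0 0) 1.
  rewrite {1}[v]sphere_split {1}[w]sphere_split !cliffD !cliffZ cliff_delta.
  rewrite -![cliff (emb _)]/(cl _) /rotor !scale1r.
  rewrite !mulmxDl !mulmxDr; congr (_ + _ + (_ + _)).
  - by rewrite -scalemxAl -scalemxAr g0_sqr scalerA scalerN scalemx1 mul_scalar_mx
      scale_scalar_mx mulrN raddfN.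
  - by rewrite -scalemxAl mul_scalar_mx.
  - by rewrite -scalemxAr mul_mx_scalar g0_cl scaleNr scalerN opprK.
  - by rewrite {1}g0_cl mulNmx mulmxA -(mulmxA _ g0 g0) g0_sqr mulmxN mulmx1 mulNmx opprK.
rewrite mulmxA const_rotor ?sqrrN ?sphere_split_norm //;
  first by rewrite const_rotor ?sphere_split_norm.
apply: even_unit_products_mul => //; apply: Spin6_rotor.
by rewrite expr1n mul1r sphere_split_norm.
Qed.

Lemma Spin6_const u : Spin6 u -> F u = F 1.
Proof.
move=> [s [s1 s2 ->]].
rewrite -[\prod_(v <- s) _]mul1mx.
(* Factors are removed in pairs, by induction on half their number with the left factor [u1]
   general. *)
suff H n : forall (r : seq 'rV[R]_6) u1, (forall v, v \in r -> sphere v /\ setT v) ->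
    Spin6 u1 -> size r = n.*2 -> F (u1 *m \prod_(v <- r) cliff v) = F u1.
  by apply: (H (size s)./2) => //; [exact: Spin6_1|rewrite even_halfK].
elim: n {s s1 s2} => [|n IHn] [|v [|w s]] // u1 s1 u1S.
  by rewrite big_nil mulmxE mulr1.
move=> [sn]; rewrite !big_cons.
have [v1 _] : sphere v /\ setT v by apply: s1; rewrite mem_head.
have [w1 _] : sphere w /\ setT w by apply: s1; rewrite !inE eqxx orbT.
have -> : u1 *m (cliff v * (cliff w * \prod_(z <- s) cliff z)) =
    (u1 *m (cliff v *m cliff w)) *m \prod_(z <- s) cliff z.
  by rewrite !mulmxE !mulrA.
rewrite IHn ?const_cliff // => [z zs|].
  by apply: s1; rewrite !inE zs !orbT.
by apply: even_unit_products_mul => //; apply: even_unit_products_pair.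
Qed.

End Constant.
End Connectedness.

(** * Product rules for curves of matrices *)

Section MatrixCurves.
Context {R : realType}.
Implicit Types (s : R).

Lemma is_derive_mulmx m n p (M : R -> 'M[R]_(m, n)) (N : R -> 'M[R]_(n, p)) s M' N' :
  is_derive s (1 : R) M M' -> is_derive s (1 : R) N N' ->
  is_derive s (1 : R) (fun t => M t *m N t) (M s *m N' + M' *m N s).
Proof.
move=> /is_derive_mxP dM /is_derive_mxP dN; apply/is_derive_mxP => i j.
have -> : (fun t => (M t *m N t) i j) =
    \sum_(k < n) ((fun t => M t i k) * (fun t => N t k j)).
  by apply/funext => t; rewrite mxE fct_sumE.
apply: (is_derive_eq (is_derive_sum (fun k => is_deriveM (dM i k) (dN k j)))).
rewrite !mxE -big_split; apply: eq_bigr => k _ /=; rewrite /GRing.scale /=.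
by rewrite (mulrC (N s k j)).
Qed.

Lemma is_derive_trmx m n (M : R -> 'M[R]_(m, n)) s M' :
  is_derive s (1 : R) M M' -> is_derive s (1 : R) (fun t => (M t)^T) M'^T.
Proof.
move=> /is_derive_mxP dM; apply/is_derive_mxP => i j; rewrite mxE.
have -> : (fun t => (M t)^T i j) = (fun t => M t j i).
  by apply/funext => t; rewrite mxE.
exact: dM.
Qed.

Lemma is_derive_scalemx m n (a : R -> R) (M : R -> 'M[R]_(m, n)) s a' M' :
  is_derive s (1 : R) a a' -> is_derive s (1 : R) M M' ->
  is_derive s (1 : R) (fun t => a t *: M t) (a s *: M' + a' *: M s).
Proof.
move=> da /is_derive_mxP dM; apply/is_derive_mxP => i j.
have -> : (fun t => (a t *: M t) i j) = a * (fun t => M t i j).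
  by apply/funext => t; rewrite mxE.
by apply: is_derive_eq; rewrite !mxE /GRing.scale /= (mulrC a').
Qed.

Lemma is_derive_ip n (f h : R -> 'cV[R]_n) s f' h' :
  is_derive s (1 : R) f f' -> is_derive s (1 : R) h h' ->
  is_derive s (1 : R) (fun t => ip (f t) (h t)) (ip (f s) h' + ip f' (h s)).
Proof.
move=> df dh; have := is_derive_mulmx (is_derive_trmx df) dh.
by move=> /is_derive_mxP/(_ 0 0); rewrite mxE.
Qed.

Lemma is_derive_mulmxl m n p (M : 'M[R]_(m, n)) (N : R -> 'M[R]_(n, p)) s N' :
  is_derive s (1 : R) N N' -> is_derive s (1 : R) (fun t => M *m N t) (M *m N').
Proof.
move=> dN; have := is_derive_mulmx (is_derive_cst M s (1 : R)) dN.
by rewrite mul0mx addr0.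
Qed.

Lemma is_derive_mulmxr m n p (M : R -> 'M[R]_(m, n)) (N : 'M[R]_(n, p)) s M' :
  is_derive s (1 : R) M M' -> is_derive s (1 : R) (fun t => M t *m N) (M' *m N).
Proof.
move=> dM; have := is_derive_mulmx dM (is_derive_cst N s (1 : R)).
by rewrite mulmx0 add0r.
Qed.

Lemma is_derive_spin_mx (f : R -> 'cV[R]_8) s f' : is_derive s (1 : R) f f' ->
  is_derive s (1 : R) (fun t => spin_mx (f t)) (spin_mx f').
Proof.
move=> df; apply/is_derive_mxP => i j.
have -> : (fun t => spin_mx (f t) i j) = (fun t => (e5 j *m f t) i 0).
  by apply/funext => t; rewrite mxE.
by have /is_derive_mxP/(_ i 0) := is_derive_mulmxl (e5 j) df; rewrite [spin_mx f' i j]mxE.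
Qed.

Lemma is_derive_unique {W : normedModType R} (f : R -> W) s f1 f2 :
  is_derive s (1 : R) f f1 -> is_derive s (1 : R) f f2 -> f1 = f2.
Proof. by case=> _ <- [_ <-]. Qed.

End MatrixCurves.

(** * First derivatives of a local smooth extension of the spinor *)

Section LocalExtension.
Context {R : realType} (Psi : 'M[R]_8 -> 'cV[R]_8) (A : 'rV[R]_6 -> 'M[R]_6).
Context (killing : generalized_killing_spinor Psi A).
Context (U : set 'M[R]_8) (g : 'M[R]_8 -> 'cV[R]_8).
Context (Uo : open U) (gC : forall n, is_Ck n U g).
Context (gE : forall u, U u -> Spin6 u -> g u = Psi u).
Implicit Types (x y : 'cV[R]_5) (u : 'M[R]_8).
Local Notation g0 := (gamma ord0 : 'M[R]_8).

Lemma near_rotor u x (al be : R -> R) : U u -> Spin6 u ->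
  al 0 = 1 -> be 0 = 0 -> is_derive 0 (1 : R) al 0 -> is_derive 0 (1 : R) be 1 ->
  (forall t, al t ^+ 2 + be t ^+ 2 * ip x x = 1) ->
  \forall t \near 0, U (u *m rotor x (al t) (be t)) /\ Spin6 (u *m rotor x (al t) (be t)).
Proof.
move=> Uu uS al0 be0 dal dbe ab.
have := near_rotor_curve (g0 *m cl x) al0 be0 dal dbe Uo Uu.
apply: filterS => t Ut; split=> //.
by apply: even_unit_products_mul => //; exact: Spin6_rotor.
Qed.

(** Differentiability comes from the extension [g], which agrees with [Psi] along the curve near 0;
    the value comes from [killing_curve]. *)
Lemma is_derive_killing u x (al be : R -> R) : U u -> Spin6 u ->
  al 0 = 1 -> be 0 = 0 -> is_derive 0 (1 : R) al 0 -> is_derive 0 (1 : R) be 1 ->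
  (forall t, al t ^+ 2 + be t ^+ 2 * ip x x = 1) ->
  is_derive 0 (1 : R) (fun t => Psi (u *m rotor x (al t) (be t)))
    (2 *: (cl (endo A u *m x) *m Psi u)).
Proof.
move=> Uu uS al0 be0 dal dbe ab.
have := Ck1_rotor_curve (g0 *m cl x) al0 be0 dal dbe Uo Uu (gC 1).
move=> /(near_eq_is_derive (g := fun t => Psi (u *m rotor x (al t) (be t)))).
case=> [|dP _].
  have := near_rotor Uu uS al0 be0 dal dbe ab.
  by apply: filterS => t [Ut St]; rewrite -gE.
apply: DeriveDef => //.
by rewrite -derive1E (killing_curve killing uS al0 be0 dal dbe ab).
Qed.

Lemma local_killing u x : U u -> Spin6 u ->
  'D_(u *m (g0 *m cl x)) g u = 2 *: (cl (endo A u *m x) *m Psi u).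
Proof.
move=> Uu uS; have [al [be [[al0 be0] dal dbe ab]]] := rotor_curve x.
apply: is_derive_unique (is_derive_killing Uu uS al0 be0 dal dbe ab).
have := Ck1_rotor_curve (g0 *m cl x) al0 be0 dal dbe Uo Uu (gC 1).
apply: near_eq_is_derive.
have := near_rotor Uu uS al0 be0 dal dbe ab.
by apply: filterS => t [Ut St]; rewrite -gE.
Qed.

(** For orthonormal [x] and [y] the curve [h] lies in Spin(5); differentiate
    [Psi (u *m h t) = invmx (h t) *m Psi u] at 0. *)
Lemma local_equivariance_unit u x y : U u -> Spin6 u ->
  ip x x = 1 -> ip y y = 1 -> ip x y = 0 ->
  'D_(u *m (cl x *m cl y)) g u = - (cl x *m cl y *m Psi u).
Proof.
move=> Uu uS x1 y1 xy.
have dc : is_derive (0 : R) (1 : R) cos 0 by apply: is_derive_eq; rewrite sin0 oppr0.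
have ds : is_derive (0 : R) (1 : R) sin 1 by apply: is_derive_eq; rewrite cos0.
have := Ck1_rotor_curve (cl x *m cl y) (@cos0 R) (@sin0 R) dc ds Uo Uu (gC 1).
pose h (t : R) := (cos t)%:M + sin t *: (cl x *m cl y).
have hE t : h t = cliff (emb x) *m cliff (emb ((- cos t) *: x + sin t *: y)).
  rewrite -!/(cl _) clD !clZ mulmxDr -!scalemxAr cl_sqr x1.
  by rewrite scale_scalar_mx mulrNN mulr1.
have sx : sphere (emb x) by rewrite /sphere /= dot_emb.
have h5 t : Spin5 (h t).
  rewrite hE; apply: even_unit_products_pair => //; try exact: emb0.
  rewrite /sphere /= dot_emb -/(ip _ _) !(ipDl, ipDr, ipZl, ipZr) x1 y1 xy ipC xy.
  by rewrite -[RHS](cos2Dsin2 t); ring.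
have B2 : cl x *m cl y *m (cl x *m cl y) = - 1.
  have /(canRL (addrK _)) yx := cl_clifford y x.
  rewrite -(mulmxA (cl x)) (mulmxA (cl y)) yx -/(ip y x) ipC xy mulr0 oppr0 raddf0 sub0r.
  rewrite mulNmx -mulmxA cl_sqr y1 mulmxN mulmxA cl_sqr x1 mul_scalar_mx scale_scalar_mx.
  by rewrite mulrNN mulr1.
(* [cl x *m cl y] squares to -1, so [h t] is inverted like a complex number of modulus 1. *)
have hV t : invmx (h t) = (cos t)%:M - sin t *: (cl x *m cl y).
  have hU := even_unit_products_unitmx (h5 t).
  apply: (can_inj (mulKmx hU)); rewrite mulmxV // /h mulmxDl !mulmxBr.
  rewrite -!scalemxAl -!scalemxAr B2 !mul_mx_scalar !mul_scalar_mx.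
  move: (cl x *m cl y) => B; rewrite -(cos2Dsin2 t : _ = 1 :> R).
  by apply/matrixP => i j; rewrite !mxE; case: (i == j) => /=; rewrite ?mulr1n ?mulr0n; ring.
case: killing => [[_ equiv] _ _ _].
move=> dg; apply: is_derive_unique dg _.
apply: (near_eq_is_derive (f := fun t => Psi u + (cos t - 1) *: Psi u +
    sin t *: - (cl x *m cl y *m Psi u))).
  have := near_rotor_curve (cl x *m cl y) (@cos0 R) (@sin0 R) dc ds Uo Uu.
  apply: filterS => t Ut; rewrite gE //; last first.
    apply: even_unit_products_mul => //; case: (h5 t) => s [s1 s2 hs].
    by rewrite -/(h t) hs; exists s; split=> // v /s1[].
  rewrite -/(h t) equiv // hV mulmxBl mul_scalar_mx -scalemxAl scalerN.
  by congr (_ - _); rewrite scalerBl scale1r addrC subrK.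
have dc1 : is_derive (0 : R) (1 : R) (fun t => cos t - 1) 0.
  by apply: is_derive_eq; rewrite subr0.
have := is_derive_comb (Psi u) (Psi u) (- (cl x *m cl y *m Psi u)) dc1 ds.
by rewrite scale0r add0r scale1r.
Qed.

End LocalExtension.

(** * Second derivatives of the extension *)

Section Curvature.
Context {R : realType} (Psi : 'M[R]_8 -> 'cV[R]_8) (A : 'rV[R]_6 -> 'M[R]_6).
Context (killing : generalized_killing_spinor Psi A).
Context (U : set 'M[R]_8) (g : 'M[R]_8 -> 'cV[R]_8).
Context (Uo : open U) (gC : forall n, is_Ck n U g).
Context (gE : forall u, U u -> Spin6 u -> g u = Psi u).
Implicit Types (x y : 'cV[R]_5) (u : 'M[R]_8).
Local Notation g0 := (gamma ord0 : 'M[R]_8).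

(** By Gram-Schmidt the commutator is [2 *: (cl x *m cl z)], with [z] the part of [y] orthogonal to
    [x]; after normalization the orthonormal case applies, unless [x] or [z] is zero. *)
Lemma local_equivariance u x y : U u -> Spin6 u ->
  'D_(u *m (cl x *m cl y - cl y *m cl x)) g u =
  - ((cl x *m cl y - cl y *m cl x) *m Psi u).
Proof.
move=> Uu uS.
have D0 : 'D_(u *m 0) g u = - (0 *m Psi u) by rewrite mulmx0 mul0mx oppr0 derive0.
have cl0 : cl 0 = 0 :> 'M[R]_8.
  by rewrite -(scale0r (0 : 'cV[R]_5)) clZ scale0r.
have [x0|x0] := eqVneq x 0.
  by rewrite x0 cl0 mul0mx mulmx0 subrr.
have ix0 : ip x x != 0 by rewrite ip_eq0.
pose k := ip x y / ip x x; pose z := y - k *: x.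
have yE : y = z + k *: x by rewrite subrK.
have xz : ip x z = 0 by rewrite ipDr ipNr ipZr divfK // subrr.
have -> : cl x *m cl y - cl y *m cl x = 2 *: (cl x *m cl z).
  have /(canRL (addrK _)) zx := cl_clifford z x.
  rewrite -/(ip z x) ipC xz mulr0 oppr0 raddf0 sub0r in zx.
  rewrite yE clD clZ mulmxDl mulmxDr -scalemxAl -scalemxAr zx.
  by rewrite opprD opprK addrACA subrr addr0 scaler_nat mulr2n.
have [z0|z0] := eqVneq z 0.
  by rewrite z0 cl0 mulmx0 scaler0.
pose r := Num.sqrt (ip x x); pose s := Num.sqrt (ip z z).
have r2 : r ^+ 2 = ip x x by rewrite sqr_sqrtr // ip_ge0.
have s2 : s ^+ 2 = ip z z by rewrite sqr_sqrtr // ip_ge0.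
have r0 : r != 0 by rewrite -sqrf_eq0 r2.
have s0 : s != 0 by rewrite -sqrf_eq0 s2 ip_eq0.
have := @local_equivariance_unit _ Psi A killing U g Uo gC gE u (r^-1 *: x) (s^-1 *: z) Uu uS.
rewrite !ipZl !ipZr xz !mulr0 -r2 -s2 => H.
have {}H := H _ _ erefl; rewrite !clZ in H.
have -> : 2 *: (cl x *m cl z) = (2 * r * s) *: (r^-1 *: cl x *m (s^-1 *: cl z)).
  by rewrite -scalemxAl -scalemxAr !scalerA; congr (_ *: _); field; rewrite ?r0 ?s0.
have Z q v : 'D_(q *: v) g u = q *: 'D_v g u.
  by have := Ck1_derive_lin Uo v 0 q 0 Uu (gC 1); rewrite scaler0 scale0r !addr0.
rewrite -scalemxAr Z H; [|by field..].
by rewrite scalerN; congr (- _); exact: scalemxAl.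
Qed.

Section Curve.
Context (u : 'M[R]_8) (Uu : U u) (uS : Spin6 u) (x : 'cV[R]_5) (al be : R -> R).
Context (al0 : al 0 = 1) (be0 : be 0 = 0).
Context (dal : is_derive 0 (1 : R) al 0) (dbe : is_derive 0 (1 : R) be 1).
Context (ab : forall t, al t ^+ 2 + be t ^+ 2 * ip x x = 1).
Local Notation c t := (u *m rotor x (al t) (be t)).

(* The left-hand side is the derivative of [g] at [c t] in the direction
   [c t *m (g0 *m cl y)], which is linear in [c t]. *)
Lemma is_derive_along_curve y :
  is_derive 0 (1 : R) (fun t => 2 *: (cl (endo A (c t) *m y) *m Psi (c t)))
    ('D_(u *m (g0 *m cl x)) ('D_(u *m (g0 *m cl y)) g) u + 'D_(u *m (cl x *m cl y)) g u).
Proof.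
have C1 v : is_Ck 1 U ('D_v g) by case: (gC 2) => _ /(_ v)[].
have d1 := Ck1_rotor_curve (g0 *m cl x) al0 be0 dal dbe Uo Uu (C1 (u *m (g0 *m cl y))).
have d2 := Ck1_rotor_curve (g0 *m cl x) al0 be0 dal dbe Uo Uu (C1 (u *m (cl x *m cl y))).
have := is_deriveD (is_derive_scalemx dal d1) (is_derive_scalemx dbe d2).
rewrite al0 be0 !scale1r !scale0r !addr0 add0r mulmx1.
apply: near_eq_is_derive.
have := near_rotor Uo Uu uS al0 be0 dal dbe ab.
apply: filterS => t [Ut St].
rewrite -(local_killing killing Uo gC gE) //.
rewrite -[LHS](Ck1_derive_lin Uo _ _ _ _ Ut (gC 1)); congr ('D_ _ g _).
have FF : g0 *m cl x *m (g0 *m cl y) = cl x *m cl y.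
  rewrite {1}g0_cl mulNmx mulmxA -(mulmxA (cl x) g0 g0) g0_sqr mulmxN mulmx1 mulNmx.
  by rewrite opprK.
rewrite [in RHS]/rotor mulmxDr mulmxDl mul_mx_scalar -scalemxAl; congr (_ + _).
by rewrite -scalemxAr -scalemxAl -mulmxA FF.
Qed.

Lemma is_derive_norm :
  is_derive 0 (1 : R) (fun t => ip (Psi (c t)) (Psi (c t))) 0.
Proof.
have d := is_derive_killing killing Uo gC gE Uu uS al0 be0 dal dbe ab.
apply: (is_derive_eq (is_derive_ip d d)).
rewrite al0 be0 rotor0 mulmx1 ipZr ipZl [ip (cl _ *m _) _]ipC ip_psi_cl; ring.
Qed.

Context (n : R) (n0 : n != 0) (norm : forall u, Spin6 u -> ip (Psi u) (Psi u) = n).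

(** By [ip_clcl], pairing the Killing derivative with [cl (delta_mx k 0) *m Psi] recovers the
    entries of [endo], up to the constant [2 * n]; both spinors in the pairing are
    differentiable. *)
Lemma derivable_endo : derivable (fun t => endo A (c t)) 0 (1 : R).
Proof.
apply/derivable_mxP => k j.
have d := is_derive_killing killing Uo gC gE Uu uS al0 be0 dal dbe ab.
have dk := is_derive_mulmxl (cl (delta_mx k 0)) d.
have := is_deriveZ (2 * n)^-1 (is_derive_ip dk (is_derive_along_curve (delta_mx j 0))).
have -> : (fun t => endo A (c t) k j) = (2 * n)^-1 \*: (fun t =>
  ip (cl (delta_mx k 0) *m Psi (c t)) (2 *: (cl (endo A (c t) *m delta_mx j 0) *m Psi (c t)))).
  apply/funext => t; rewrite /= ipZr ip_clcl norm; last first.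
    by apply: even_unit_products_mul => //; exact: Spin6_rotor.
  have -> : ip (delta_mx k 0) (endo A (c t) *m delta_mx j 0) = endo A (c t) k j.
    by rewrite /ip trmx_delta -rowE mxE -colE mxE.
  by rewrite /GRing.scale /=; field.
by case.
Qed.

End Curve.
End Curvature.

(** * The curvature equation, and constancy of the eigenvalue *)

Section KillingRigidity.
Context {R : realType} (Psi : 'M[R]_8 -> 'cV[R]_8) (A : 'rV[R]_6 -> 'M[R]_6).
Context (killing : generalized_killing_spinor Psi A).
Implicit Types (x y : 'cV[R]_5) (u : 'M[R]_8).
Local Notation g0 := (gamma ord0 : 'M[R]_8).
Local Notation E0 := (delta_mx 0 ord0 : 'rV[R]_6).

Lemma local_extension u : Spin6 u -> exists U g,
  [/\ open U, U u, (forall n, is_Ck n U g) &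
      forall v, U v -> Spin6 v -> g v = Psi v].
Proof. by case: killing => [[sm _] _ _ _] /sm. Qed.

(** Clifford multiplication is skew, so the norm has zero horizontal derivative and [Spin6_const]
    applies; positivity comes from the point where [Psi] is non-zero. *)
Lemma norm_const : exists2 n : R, 0 < n &
  forall u, Spin6 u -> ip (Psi u) (Psi u) = n.
Proof.
have cst u : Spin6 u -> ip (Psi u) (Psi u) = ip (Psi 1) (Psi 1).
  apply: (@Spin6_const R (fun u => ip (Psi u) (Psi u))) => v x al be vS al0 be0 dal dbe ab.
  have [U [g [Uo Uv gC gE]]] := local_extension vS.
  exact: (is_derive_norm killing Uo gC gE Uv vS al0 be0 dal dbe ab).
exists (ip (Psi 1) (Psi 1)) => //.
case: killing => _ [u uS Pu] _ _.
by rewrite -(cst u uS) lt_neqAle eq_sym ip_eq0 Pu ip_ge0.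
Qed.

Context (n : R) (n_gt0 : 0 < n) (norm : forall u, Spin6 u -> ip (Psi u) (Psi u) = n).

Definition adapted_curve x (p : (R -> R) * (R -> R)) : Prop :=
  [/\ p.1 0 = 1 /\ p.2 0 = 0, is_derive 0 (1 : R) p.1 0, is_derive 0 (1 : R) p.2 1 &
      forall t, p.1 t ^+ 2 + p.2 t ^+ 2 * ip x x = 1].

(** The second derivatives of [g] in the directions of [g0 *m cl x] and [g0 *m cl y] commute.
    Exchanging [x] and [y] therefore leaves only a derivative in a vertical direction, known from
    [local_equivariance]. *)
Lemma curvature u (ab : 'cV[R]_5 -> (R -> R) * (R -> R)) : Spin6 u ->
  (forall x, adapted_curve x (ab x)) ->
  exists da : 'cV[R]_5 -> 'M[R]_5, [/\ forall x, (da x)^T = da x,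
    forall x, is_derive 0 (1 : R)
      (fun t => endo A (u *m rotor x ((ab x).1 t) ((ab x).2 t))) (2 *: da x) &
    forall x y, cl (da x *m y - da y *m x) *m Psi u =
      cl (endo A u *m x) *m (cl (endo A u *m y) *m Psi u)
      - cl (endo A u *m y) *m (cl (endo A u *m x) *m Psi u)
      - 4^-1 *: (cl x *m (cl y *m Psi u) - cl y *m (cl x *m Psi u))].
Proof.
move=> uS abP.
have [U [g [Uo Uu gC gE]]] := local_extension uS.
pose c x t := u *m rotor x ((ab x).1 t) ((ab x).2 t).
have cS x t : Spin6 (c x t).
  by case: (abP x) => _ _ _ h; apply: even_unit_products_mul => //; exact: Spin6_rotor.
have c0 x : c x 0 = u.
  by case: (abP x) => [[a0 b0] _ _ _]; rewrite /c a0 b0 rotor0 mulmx1.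
(* Halved because the base point moves with velocity [2 *: x] in the frame. *)
pose da x := 2^-1 *: 'D_1 (fun t => endo A (c x t)) 0.
have two0 : (2 : R) != 0 by rewrite pnatr_eq0.
have dE x : is_derive 0 (1 : R) (fun t => endo A (c x t)) (2 *: da x).
  rewrite /da scalerA divff // scale1r; apply/derivableP.
  case: (abP x) => [[a0 b0] da' db ab1].
  exact: (derivable_endo killing Uo gC gE Uu uS a0 b0 da' db ab1 (lt0r_neq0 n_gt0) norm).
exists da; split=> [x|//|x y].
  apply: (scalerI two0); rewrite -linearZ /=.
  apply: is_derive_unique (dE x).
  have := is_derive_trmx (dE x).
  by under eq_fun do rewrite (endo_sym killing) //.
(* Two derivatives of the Killing equation along the curve are compared: through [g], and by the
   product rule for [endo] and [Psi]. *)
have S x' y' : 'D_(u *m (g0 *m cl x')) ('D_(u *m (g0 *m cl y')) g) u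
    + 'D_(u *m (cl x' *m cl y')) g u = 4 *: (cl (da x' *m y') *m Psi u
    + cl (endo A u *m y') *m (cl (endo A u *m x') *m Psi u)).
  case: (abP x') => [[a0 b0] da' db ab1].
  have := is_derive_along_curve killing Uo gC gE Uu uS a0 b0 da' db ab1 y'.
  move=> /is_derive_unique; apply.
  have dP := is_derive_killing killing Uo gC gE Uu uS a0 b0 da' db ab1.
  have := is_deriveZ 2 (is_derive_mulmx (is_derive_spin_mx dP) (is_derive_mulmxr y' (dE x'))).
  rewrite -/(c x' 0) c0 !spin_mxE -scalemxAl clZ -scalemxAl -scalemxAr -scalerDr scalerA.
  have -> : 2 * 2 = 4 :> R by ring.
  by congr (is_derive _ _ _ _); apply/funext => t; rewrite /= spin_mxE.
have := local_equivariance killing Uo gC gE x y Uu uS.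
have D12 := Ck2_schwarz Uo (u *m (g0 *m cl x)) (u *m (g0 *m cl y)) Uu (gC 2).
have Sxy := S x y; have Syx := S y x; rewrite D12 in Sxy.
have lin v w : 'D_(v - w) g u = 'D_v g u - 'D_w g u.
  by have := Ck1_derive_lin Uo v w 1 (-1) Uu (gC 1); rewrite !scale1r !scaleN1r.
have clB v w : cl (v - w) = cl v - cl w :> 'M[R]_8.
  by rewrite -scaleN1r clD clZ scaleN1r.
have {Sxy Syx}S : 'D_(u *m (cl x *m cl y)) g u - 'D_(u *m (cl y *m cl x)) g u =
    4 *: (cl (da x *m y) *m Psi u + cl (endo A u *m y) *m (cl (endo A u *m x) *m Psi u))
  - 4 *: (cl (da y *m x) *m Psi u + cl (endo A u *m x) *m (cl (endo A u *m y) *m Psi u)).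
  have cancel (P a b X Y : 'cV[R]_8) : P + a = X -> P + b = Y -> a - b = X - Y.
    by move=> <- <-; rewrite opprD addrACA subrr add0r.
  exact: cancel Sxy Syx.
rewrite mulmxBr lin S mulmxBl -!mulmxA clB mulmxBl.
move: (cl (da x *m y) *m _) (cl (da y *m x) *m _) (cl _ *m (cl (_ *m x) *m _))
  (cl _ *m (cl (_ *m y) *m _)) (cl x *m _) (cl y *m _) => p q p1 q1 p2 q2.
move=> /colP H; apply/colP => i; have := H i; rewrite !mxE; lra.
Qed.

Lemma is_derive_reeb (f : R -> 'cV[R]_8) (s : R) f' : is_derive s (1 : R) f f' ->
  is_derive s (1 : R) (fun t => reeb (f t))
    ((spin_mx (f s))^T *m (volume *m f') + (spin_mx f')^T *m (volume *m f s)).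
Proof.
move=> df; apply: is_derive_mulmx; last exact: is_derive_mulmxl.
exact/is_derive_trmx/is_derive_spin_mx.
Qed.

(** The two summands are equal, since [volume] is skew and commutes with the skew matrices
    [cl z]. *)
Lemma reeb_variation (psi : 'cV[R]_8) y :
  (spin_mx psi)^T *m (volume *m (cl y *m psi))
  + (spin_mx (cl y *m psi))^T *m (volume *m psi) =
  2 *: (omega psi volume *m y).
Proof.
rewrite scaler_nat mulr2n; congr (_ + _).
  by rewrite /omega -2!mulmxA spin_mxE.
apply: ip_ext => z; rewrite /omega -2!mulmxA -!ip_adj !spin_mxE.
by rewrite ip_cl (mulmxA (cl z)) -J_cl -mulmxA -ip_J ipC.
Qed.

Lemma endo_scalar u : Spin6 u ->
  exists mu : R, endo A u = mu%:M /\ 4 * mu ^+ 2 = 1.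
Proof.
have /choice[ab abP] : forall x, exists p, adapted_curve x p.
  by move=> x; have [al [be [? ? ? ?]]] := rotor_curve x; exists (al, be).
pose k := (Num.sqrt n)^-1.
have k2 : k ^+ 2 * n = 1.
  by rewrite /k exprVn sqr_sqrtr ?ltW // mulVf // lt0r_neq0.
have curv v : Spin6 v -> exists da : 'cV[R]_5 -> 'M[R]_5, [/\ forall x, (da x)^T = da x,
    forall x, is_derive 0 (1 : R)
      (fun t => endo A (v *m rotor x ((ab x).1 t) ((ab x).2 t))) (2 *: da x) &
    forall x y, cl (da x *m y - da y *m x) *m (k *: Psi v) =
      cl (endo A v *m x) *m (cl (endo A v *m y) *m (k *: Psi v))
      - cl (endo A v *m y) *m (cl (endo A v *m x) *m (k *: Psi v))
      - 4^-1 *: (cl x *m (cl y *m (k *: Psi v)) - cl y *m (cl x *m (k *: Psi v)))].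
  move=> vS; have [da [daT dE curv]] := curvature vS abP.
  exists da; split=> // x y; rewrite -!scalemxAr curv.
  by rewrite !scalerBr !scalerA (mulrC 4^-1) -!scalerA.
have unit v : Spin6 v -> ip (k *: Psi v) (k *: Psi v) = 1.
  by move=> vS; rewrite ipZl ipZr norm // mulrA -expr2.
move=> uS; have [da [daT dE curvu]] := curv u uS.
have psi1 := unit u uS.
set psi := k *: Psi u in psi1 curvu.
have /choice[dmu dmuP] : forall x, exists m, da x *m reeb psi
    + endo A u *m (2 *: (omega psi volume *m (endo A u *m x))) =
    m *: reeb psi
    + reeb_eigenvalue (endo A u) psi *: (2 *: (omega psi volume *m (endo A u *m x))).
  move=> x; case: (abP x) => [[a0 b0] da' db ab1].
  pose c t := u *m rotor x ((ab x).1 t) ((ab x).2 t).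
  have cS t : Spin6 (c t).
    by apply: even_unit_products_mul => //; exact: Spin6_rotor.
  have c0 : c 0 = u by rewrite /c a0 b0 rotor0 mulmx1.
  have [U [g [Uo Uu gC gE]]] := local_extension uS.
  have dP := is_derive_killing killing Uo gC gE Uu uS a0 b0 da' db ab1.
  have dpsi : is_derive 0 (1 : R) (fun t => k *: Psi (c t))
      (cl (2 *: (endo A u *m x)) *m psi).
    apply: (is_derive_eq (is_deriveZ k dP)).
    by rewrite clZ -scalemxAl /psi -scalemxAr !scalerA mulrC.
  have dxi := is_derive_reeb dpsi; rewrite c0 reeb_variation -scalemxAr in dxi.
  have dl := is_derive_mulmx (dE x) dxi.
  have dm := is_derive_ip dxi dl.
  set m' := (X in is_derive _ _ _ X) in dm.
  have dr := is_derive_scalemx dm dxi.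
  (* The curvature equation holds at every point [c t], so the eigenvalue equation may be
     differentiated along the curve. *)
  have eigen t : endo A (c t) *m reeb (k *: Psi (c t)) =
      ip (reeb (k *: Psi (c t))) (endo A (c t) *m reeb (k *: Psi (c t)))
        *: reeb (k *: Psi (c t)).
    have [da2 [_ _ curv2]] := curv _ (cS t).
    exact: (reeb_eigen (unit _ (cS t)) (endo_sym killing (cS t)) curv2).
  have E := is_derive_unique dl; rewrite (funext eigen) in E.
  have {}E := E _ dr; rewrite /= -/(c 0) c0 -/psi -/(reeb_eigenvalue _ _) in E.
  exists (2^-1 * m').
  have two0 : (2 : R) != 0 by rewrite pnatr_eq0.
  apply: (scalerI two0); rewrite !scalerDr !scalerA.
  rewrite mulVKf // -scalemxAl in E *.
  rewrite -!scalemxAr !scalerA in E *.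
  rewrite addrC E addrC; congr (_ + _ *: _); ring.
have [aE mu1] := killing_rigidity psi1 (endo_sym killing uS) daT curvu dmuP.
by exists (reeb_eigenvalue (endo A u) psi).
Qed.

(** The diagonal entry is differentiable with constant square 1/4, so its derivative times a
    non-zero number vanishes, and [Spin6_const] applies. *)
Lemma endo_const u : Spin6 u -> endo A u = (endo A 1 0 0)%:M.
Proof.
have scal v : Spin6 v -> endo A v = (endo A v 0 0)%:M /\ 4 * endo A v 0 0 ^+ 2 = 1.
  by move=> vS; have [mu [-> mu1]] := endo_scalar vS; rewrite mxE eqxx mulr1n.
move=> uS; suff h : endo A u 0 0 = endo A 1 0 0.
  by have [-> _] := scal u uS; rewrite h.
apply: (@Spin6_const R (fun u => endo A u 0 0)) uS => v x al be vS al0 be0 dal dbe ab.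
have [U [g [Uo Uv gC gE]]] := local_extension vS.
have := derivable_endo killing Uo gC gE Uv vS al0 be0 dal dbe ab (lt0r_neq0 n_gt0) norm.
move=> /derivableP/is_derive_mxP/(_ 0 0); set d := (X in is_derive _ _ _ X) => dd.
have d2 := is_deriveM dd dd.
have cS t : Spin6 (v *m rotor x (al t) (be t)).
  by apply: even_unit_products_mul => //; exact: Spin6_rotor.
have E : (fun t => endo A (v *m rotor x (al t) (be t)) 0 0)
    * (fun t => endo A (v *m rotor x (al t) (be t)) 0 0) = cst 4^-1.
  apply/funext => t; rewrite /= -[LHS]expr2.
  by have [_ h] := scal _ (cS t); lra.
rewrite E in d2.
have := is_derive_unique d2 (is_derive_cst _ _ _).
rewrite al0 be0 rotor0 mulmx1 /GRing.scale /= => d0.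
have a0 : endo A v 0 0 != 0.
  apply/eqP => h; have [_] := scal v vS.
  by rewrite h expr0n mulr0 => /eqP; rewrite eq_sym oner_eq0.
have : endo A v 0 0 * d = 0 by lra.
by move/eqP; rewrite mulf_eq0 (negbTE a0) /= => /eqP d00; rewrite d00 in dd.
Qed.

End KillingRigidity.

(** * Spin frames over every point of the sphere *)

Section Frames.
Context {R : realType}.
Implicit Types (x : 'cV[R]_5) (u : 'M[R]_8) (v X : 'rV[R]_6).
Local Notation E0 := (delta_mx 0 ord0 : 'rV[R]_6).

Lemma base_pt_surj v : sphere v -> exists2 u, Spin6 u & base_pt u = v.
Proof.
move=> v1; have N := sphere_split_norm v1; have S := sphere_split v.
set y := \col_ _ _ in N S; set e := v 0 0 in N S.
(* At the antipode of e_0 the half-angle is pi/2, so [al = 0] and any unit [z] serves. *)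
have [e1|e1] := eqVneq e (-1).
  have y0 : y = 0 by apply/eqP; rewrite -ip_eq0; apply/eqP; move: N; rewrite e1; lra.
  pose z : 'cV[R]_5 := delta_mx 0 0.
  have ab : 0 ^+ 2 + 1 ^+ 2 * ip z z = 1.
    by rewrite /ip trmx_delta -rowE !mxE /= !expr2; ring.
  exists (rotor z 0 1); first exact: Spin6_rotor.
  rewrite /base_pt covering_rotor_E0 // S e1 y0.
  by apply/rowP => i; rewrite !mxE; case: unliftP => [j|] _; rewrite ?mxE; ring.
have e_gt : 0 < 1 + e.
  have h : e ^+ 2 <= 1 by rewrite -N lerDl ip_ge0.
  rewrite -ltrBlDl sub0r lt_neqAle eq_sym e1 /= leNgt; apply/negP => e_lt.
  nra.
(* Half-angle formula: [2 * al ^+ 2 - 1 = e], and [be = (2 * al)^-1] gives [emb y] the coefficient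
   1. *)
pose al := Num.sqrt ((1 + e) / 2).
have al2 : al ^+ 2 = (1 + e) / 2 by rewrite sqr_sqrtr // divr_ge0 // ltW.
have al0 : al != 0 by rewrite -sqrf_eq0 al2 mulf_neq0 ?invr_eq0 ?pnatr_eq0 // lt0r_neq0.
have ab : al ^+ 2 + (2 * al)^-1 ^+ 2 * ip y y = 1.
  have -> : ip y y = (1 - e) * (2 * al ^+ 2) by rewrite al2; move: N; lra.
  rewrite exprVn exprMn.
  have -> : (2 ^+ 2 * al ^+ 2)^-1 * ((1 - e) * (2 * al ^+ 2)) = (1 - e) / 2.
    by field.
  by rewrite al2; field.
exists (rotor y al (2 * al)^-1); first exact: Spin6_rotor.
rewrite /base_pt covering_rotor_E0 // [RHS]S; congr (_ *: _ + _).
  by rewrite al2; field.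
by rewrite divff ?scale1r // mulf_neq0 // pnatr_eq0.
Qed.

(** Expand [X] in the orthonormal basis of images of the standard basis under [covering u]; the
    first one is [base_pt u], orthogonal to [X]. *)
Lemma tangent_frame u X : Spin6 u -> tangent (base_pt u) X ->
  X = covering u (emb (\col_k dot X (frame u k))).
Proof.
move=> uS tX; pose O : 'M[R]_6 := \matrix_i covering u (delta_mx 0 i).
have OO : O *m O^T = 1%:M.
  apply/matrixP => i j.
  have -> : (O *m O^T) i j = dot (covering u (delta_mx 0 i)) (covering u (delta_mx 0 j)).
    by rewrite mxE; apply: eq_bigr => k _; rewrite !mxE.
  rewrite dot_covering // /dot (bigD1 i) //= big1 => [|k ki].
    by rewrite !mxE !eqxx /= addr0 mul1r.
  by rewrite mxE (negbTE ki) andbF mul0r.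
have {}OO := mulmx1C OO.
rewrite -[LHS]mulmx1 -OO mulmxA mulmx_sum_row big_ord_recl.
have XO i : (X *m O^T) 0 i = dot X (covering u (delta_mx 0 i)).
  by rewrite mxE; apply: eq_bigr => j _; rewrite !mxE.
rewrite XO [dot X _]dotC [dot _ X]tX scale0r add0r covering_embE //.
by apply: eq_bigr => k _; rewrite XO mxE rowK.
Qed.

End Frames.

Theorem theorem4p9 (R : realType) (Psi : 'M[R]_8 -> 'cV[R]_8)
    (A : 'rV[R]_6 -> 'M[R]_6)
    (hPsi : generalized_killing_spinor Psi A) :
  real_killing_spinor Psi A.
Proof.
split=> //; have [n n_gt0 norm] := norm_const hPsi.
(* The constant is read at the identity of Spin(6), and [4 * mu ^+ 2 = 1] makes it non-zero. *)
have [mu [aE mu1]] := endo_scalar hPsi n_gt0 norm Spin6_1.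
exists mu => [|x X x1 tX].
  by apply/eqP => mu0; move: mu1; rewrite mu0 expr0n mulr0 => /eqP; rewrite eq_sym oner_eq0.
(* Each point of the sphere carries a spin frame [u], in which the matrix of [A] is again
   [mu%:M]. *)
have [u uS ux] := base_pt_surj x1; rewrite -ux in tX *.
have uE : endo A u = mu%:M.
  by rewrite (endo_const hPsi n_gt0 norm uS) aE mxE eqxx mulr1n.
case: hPsi => _ _ [_ /(_ _ (sphere_base_pt uS))[tA _]] _.
set y := \col_k dot X (frame u k).
have XE : X = covering u (emb y) by exact: tangent_frame.
rewrite [LHS](tangent_frame uS (tA X tX)).
have -> : \col_k dot (X *m A (base_pt u)) (frame u k) = mu *: y.
  by apply/colP => k; rewrite mxE {1}XE endoE // uE mul_scalar_mx.
rewrite embZ XE; have := @covering_lin _ u mu 0 (emb y) 0 uS.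
by rewrite !scale0r !addr0.
Qed.
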